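(* Let $A \subset \mathbb{R}$ be a finite nonempty set. Then there exists $a \in A$ such that $$|A(A+a)| \gtrsim |A|^{\frac{3}{2}+\frac{1}{186}}.$$
   Context: For sets $X,Y\subset\mathbb{R}$, $XY=\{xy: x\in X, y\in Y\}$ and $A+a=\{x+a : x\in A\}$. Notation: $X \ll Y$ (equivalently $Y\gg X$) means $X\le cY$ for an absolute constant $c>0$. $X \gtrsim Y$ means there is an absolute constant $c>0$ such that $X \gg Y/(\log X)^c$ (constant and logarithmic factors are suppressed). Logarithms are base 2. *)

(* Defs.v *)
From HB Require Import structures.
From mathcomp Require Import all_boot all_order all_algebra.
From mathcomp Require Import finmap.
From mathcomp Require Import all_classical all_reals all_analysis.
From mathcomp Require Import Rstruct Rstruct_topology.
From Stdlib Require Import Rdefinitions.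
Set Implicit Arguments. Unset Strict Implicit. Unset Printing Implicit Defensive.
Import Order.TTheory GRing.Theory Num.Theory.
Local Open Scope ring_scope.
Local Open Scope fset_scope.

Definition prodShift (A : {fset Rdefinitions.R}) (a : Rdefinitions.R)
  : {fset Rdefinitions.R} :=
  [fset x * (y + a) | x in A, y in A].

Definition log2 (x : Rdefinitions.R) : Rdefinitions.R := ln x / ln 2.

(* Main.v *)
(* If the sets A(A + a) all have about |A|^(3/2) elements, every equation
   x(y + a) = x'(y' + a) has many solutions. Their number is at most
   sum_m rat(m) N(m), where rat(m) counts the pairs of A with quotient m and N(m)
   the triples with (y + a)/(y' + a) = m. As sum_m N(m)^2 counts collinear
   triples in a grid, it is O(|A|^4 log^2 |A|) by Szemeredi-Trotter, and
   Cauchy-Schwarz makes the multiplicative energy of A nearly |A|^3.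

   A dyadic set B of popular products of A then has many dilates meeting A, so
   Szemeredi-Trotter also controls the third moments of the difference
   representations of B and of a large A' in A, and the additive energy of B
   with A(A + a). On the other hand x(y + a) + ae = (x + e)(xy/(x + e) + a), so
   that A(A + a) meets its translates by ae in large sets (Katz-Koester). Hoelder's
   inequality turns this into a lower bound for the same additive energy that
   is incompatible with the upper one, which yields even the exponent 119/79.

   Only Cartesian grids occur, and for them the Szemeredi-Trotter bound is
   elementary: see [grid_third_moment]. *)
Require Import Defs.
From HB Require Import structures.
From mathcomp Require Import all_boot all_order all_algebra.
From mathcomp Require Import finmap.
From mathcomp Require Import all_classical all_reals all_analysis.
From mathcomp Require Import Rstruct Rstruct_topology.
From mathcomp Require Import ring lra zify.
Set Implicit Arguments. Unset Strict Implicit. Unset Printing Implicit Defensive.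
Import Order.TTheory GRing.Theory Num.Theory.
Local Open Scope ring_scope.

(** * Incidences with Cartesian grids *)

(** Write n for |A|, s for the largest |A(A + a)| and E for the multiplicative energy of A. The
    bounds n^6 <= s^2 E and E <= n^3 give only the exponent 3/2, so the case E = n^3, s = n^(3/2)
    (up to logarithms) has to be excluded. There [B] consists of about n products with b = n
    representations each, and t, the number of pairs of A with product in [B], is n^2. The equation
    x(y + a) = x'(y' + a) says that xy - x'y' = a(x' - x), so its solutions over [B] are counted by
    additive representations. To make the Katz-Koester translates large, only ratios x/x' with at
    least D representations are kept; D is the largest threshold for which the discarded ratios
    provably cost at most half of the solutions. Hoelder's inequality then gives Q^3 D^2 <= Z V n (X
    + Y), where Q bounds the solutions from below. In the critical case it would read n^(25/2) <=
    n^(49/4), and this gap is the source of the gain. The grid bound needs lines of positive slope,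
    hence a reduction to positive elements. Inequalities are kept squared or cubed, since roots and
    logarithms enter only at the end. *)

Section Grids.
Variable R : realFieldType.

Lemma sum_CauchySchwarz (I : Type) (s : seq I) (f g : I -> R) :
  (\sum_(i <- s) f i * g i) ^+ 2 <=
  (\sum_(i <- s) f i ^+ 2) * (\sum_(i <- s) g i ^+ 2).
Proof.
rewrite expr2 !big_distrlr /=.
set L := \sum_(i <- s) _; set M := \sum_(i <- s) _.
have eM : M = \sum_(i <- s) \sum_(j <- s) f j ^+ 2 * g i ^+ 2.
  by rewrite /M exchange_big.
suff : 0 <= (M + M) - (L + L) by lra.
rewrite {1}eM /M /L -!big_split /= -sumrB; apply: sumr_ge0 => i _.
rewrite -!big_split /= -sumrB; apply: sumr_ge0 => j _.
have := sqr_ge0 (f j * g i - f i * g j); nra.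
Qed.

Lemma sum_sq_le (I : Type) (s : seq I) (f : I -> R) :
  (\sum_(i <- s) f i) ^+ 2 <= (size s)%:R * \sum_(i <- s) f i ^+ 2.
Proof.
have := sum_CauchySchwarz s (fun=> 1) f.
rewrite (eq_bigr f) => [|i _]; last by rewrite mul1r.
by rewrite expr1n big_const_seq count_predT iter_addr addr0.
Qed.

Lemma ler_sum_seq (I : eqType) (s : seq I) (P : pred I) (F G : I -> R) :
  (forall i, i \in s -> P i -> F i <= G i) ->
  \sum_(i <- s | P i) F i <= \sum_(i <- s | P i) G i.
Proof.
move=> FG; rewrite [leLHS]big_seq_cond [leRHS]big_seq_cond.
by apply: ler_sum => i /andP[]; apply: FG.
Qed.

Lemma ler_sum_sub (I : eqType) (s t : seq I) (F : I -> R) :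
  uniq s -> {subset s <= t} -> (forall i, i \in t -> 0 <= F i) ->
  \sum_(i <- s) F i <= \sum_(i <- t) F i.
Proof.
elim: s t => [|x s IH] t; first by move=> _ _ F0; rewrite big_nil big_seq sumr_ge0.
move=> /andP[xs us] sub F0; have xt : x \in t by apply: sub; rewrite mem_head.
rewrite big_cons (big_rem x xt) /= lerD2l; apply: IH => // [y ys|i /mem_rem]; last exact: F0.
have yt : y \in t by apply: sub; rewrite in_cons ys orbT.
by move: yt; rewrite (perm_mem (perm_to_rem xt)) in_cons => /orP[/eqP yx|//];
   rewrite -yx ys in xs.
Qed.

Lemma ler_sum_inj (I J : eqType) (s : seq I) (t : seq J) (P : pred I)
    (h : I -> J) (F : I -> R) (G : J -> R) :
  uniq s ->
  (forall i, i \in s -> P i -> h i \in t) ->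
  (forall i j, i \in s -> j \in s -> P i -> P j -> h i = h j -> i = j) ->
  (forall i, i \in s -> P i -> F i <= G (h i)) ->
  (forall j, j \in t -> 0 <= G j) ->
  \sum_(i <- s | P i) F i <= \sum_(j <- t) G j.
Proof.
move=> us ht hinj FG G0.
apply: (@le_trans _ _ (\sum_(j <- [seq h i | i <- s & P i]) G j)).
  by rewrite big_map big_filter; apply: ler_sum_seq.
apply: ler_sum_sub => //.
  rewrite map_inj_in_uniq ?filter_uniq // => i j.
  by rewrite !mem_filter => /andP[Pi si] /andP[Pj sj]; apply: hinj.
by move=> j /mapP[i]; rewrite mem_filter => /andP[Pi si] ->; apply: ht.
Qed.

Lemma sum_indic (I : eqType) (s : seq I) (a : I) (F : I -> R) :
  uniq s -> \sum_(i <- s) (a == i)%:R * F i = (a \in s)%:R * F a.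
Proof.
move=> us; have [as_|as_] := boolP (a \in s); last first.
  rewrite mul0r big_seq big1 // => i is_; have [ai|_] := eqVneq a i.
    by rewrite ai is_ in as_.
  by rewrite mul0r.
rewrite (bigD1_seq a) //= eqxx big1 ?addr0 // => i; rewrite eq_sym => /negPf->.
by rewrite mul0r.
Qed.

Lemma sum_fiber (I J : eqType) (s : seq I) (t : seq J) (h : I -> J) (F : J -> R) :
  uniq t -> (forall i, i \in s -> h i \in t) ->
  \sum_(i <- s) F (h i) = \sum_(j <- t) (\sum_(i <- s) (h i == j)%:R) * F j.
Proof.
move=> ut ht.
rewrite (eq_bigr (fun j => \sum_(i <- s) (h i == j)%:R * F j)); last first.
  by move=> j _; rewrite mulr_suml.
rewrite exchange_big /= big_seq [RHS]big_seq; apply: eq_bigr => i is_.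
by rewrite sum_indic // ht // mul1r.
Qed.

(** AM-GM for [p], [q] and [3 - p - q], whose mean is 1; if the third is negative, so is the left
    side. *)
Lemma amgm3 (p q : R) : 0 < p -> 0 < q -> (3 - p - q) * (p * q) <= 1.
Proof.
move=> p0 q0.
(* With s = p + q this is 4 - (3 - s) s^2, which settles p = q; the term in (p - q)^2 below reduces
   to that case. *)
have h1 : 0 <= (p + q - 2) * (p + q - 2) * (p + q + 1).
  by rewrite mulr_ge0 -?expr2 ?sqr_ge0 //; lra.
have [s3|s3] := lerP (p + q) 3.
  have : 0 <= (3 - p - q) * ((p - q) * (p - q)).
    by rewrite mulr_ge0 -?expr2 ?sqr_ge0 //; lra.
  lra.
apply: (@le_trans _ _ 0); last exact: ler01.
by rewrite mulr_le0_ge0 ?mulr_ge0 ?ltW //; lra.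
Qed.

(* Each pair at distances [u, v] satisfies [1/(uv) >= (3 - u/U - v/V)/(UV)]
   by AM-GM, and the distances telescope along the chain. *)
Lemma sum_inv_chain (I : eqType) (f g : I -> R) (U V : R) (x : I) (s : seq I) :
  0 < U -> 0 < V ->
  path (fun a b => (f a < f b) && (g a < g b)) x s ->
  ((size s)%:R * 3 - (f (last x s) - f x) / U - (g (last x s) - g x) / V) / (U * V)
  <= \sum_(a <- x :: s) \sum_(b <- x :: s | (f a < f b) && (g a < g b))
       ((f b - f a) * (g b - g a))^-1.
Proof.
move=> U0 V0.
have wpos a b : (f a < f b) && (g a < g b) -> 0 <= ((f b - f a) * (g b - g a))^-1.
  by case/andP=> fab gab; rewrite invr_ge0 mulr_ge0 // subr_ge0 ltW.
elim: s x => [|y s IH] x.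
  move=> _ /=; rewrite !subrr !mul0r !subr0 mul0r.
  by apply: sumr_ge0 => a _; apply: sumr_ge0 => b; apply: wpos.
rewrite [path _ _ _]/= => /andP[xy pys].
suff : ((size (y :: s))%:R * 3 - (f (last x (y :: s)) - f x) / U -
   (g (last x (y :: s)) - g x) / V) / (U * V) <=
  ((f y - f x) * (g y - g x))^-1 +
  \sum_(a <- y :: s) \sum_(b <- y :: s | (f a < f b) && (g a < g b))
       ((f b - f a) * (g b - g a))^-1.
  move=> /le_trans; apply; rewrite [leRHS]big_cons; apply: lerD.
    rewrite 2!big_cons !ltxx /= xy lerDl.
    by apply: sumr_ge0 => b; apply: wpos.
  apply: ler_sum => a _; rewrite [leRHS]big_cons; case: ifP => // ax.
  by rewrite lerDr; apply: wpos.
have {IH} := IH y pys; rewrite [last x _]/= [size _]/=.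
set S := \sum_(a <- _) _ => IH; apply: le_trans (lerD (lexx _) IH).
case/andP: xy => fxy gxy.
set u := f y - f x; set v := g y - g x.
have u0 : 0 < u by rewrite subr_gt0.
have v0 : 0 < v by rewrite subr_gt0.
rewrite -lerBlDr -mulrBl.
set F := f (last y s); set G := g (last y s).
have -> : (size s).+1%:R * 3 - (F - f x) / U - (G - g x) / V
  - ((size s)%:R * 3 - (F - f y) / U - (G - g y) / V) = 3 - u / U - v / V :> R.
  by rewrite -natr1 /u /v; field; rewrite !gt_eqF.
rewrite ler_pdivrMr ?mulr_gt0 // [leRHS]mulrC ler_pdivlMr ?mulr_gt0 //.
set p := u / U; set q := v / V.
have -> : u = p * U by rewrite divfK ?gt_eqF.
have -> : v = q * V by rewrite divfK ?gt_eqF.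
have p0 : 0 < p by rewrite divr_gt0.
have q0 : 0 < q by rewrite divr_gt0.
have -> : (3 - p - q) * (p * U * (q * V)) = ((3 - p - q) * (p * q)) * (U * V) by ring.
rewrite -[leRHS]mul1r ler_wpM2r //; first by rewrite mulr_ge0 // ltW.
exact: amgm3.
Qed.

Definition harmonic_sum (k : nat) : R := \sum_(0 <= j < k) (j.+1%:R)^-1.

Lemma harmonic_sum_le j k : (j <= k)%N -> harmonic_sum j <= harmonic_sum k.
Proof.
move=> jk; apply: ler_sum_sub => [|i|i _]; first exact: iota_uniq.
  by rewrite !mem_index_iota /= => /leq_trans; apply.
by rewrite invr_ge0 ler0n.
Qed.

Lemma harmonic_sum_ge0 k : 0 <= harmonic_sum k.
Proof. by apply: sumr_ge0 => i _; rewrite invr_ge0 ler0n. Qed.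

(** Points are measured by rank instead of value: increasing lines respect the order, and rank gaps
    are distinct positive integers, so that sums of their inverses are harmonic whatever the spacing
    of the set. *)
Definition rank (X : {fset R}) (x : R) : nat := count (fun z => z < x) X.

Lemma rank_lt X x y : x \in X -> x < y -> (rank X x < rank X y)%N.
Proof.
move=> xX xy; rewrite /rank.
have -> : count (fun z => z < y) X = (count (fun z => (z < x)%R) X
    + count (fun z => (x <= z < y)%R) X)%N.
  rewrite -[RHS]count_predUI.
  rewrite [X in (_ + X)%N](_ : _ = 0%N) ?addn0; last first.
    apply/eqP; rewrite -leqn0 leqNgt -has_count; apply/hasPn => z _ /=.
    by case: ltP => //=.
  apply: eq_count => z /=; case: (ltP z x) => //= zx.
  exact: lt_trans zx xy.
rewrite -[X in (X < _)%N]addn0 ltn_add2l -has_count; apply/hasP; exists x => //.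
by rewrite lexx xy.
Qed.

Lemma rank_le_card X x : x \in X -> (rank X x < #|` X|%fset)%N.
Proof.
move=> xX; rewrite /rank cardfE -[X in (_ < X)%N]cardfE.
have -> : #|` X|%fset = (rank X x + count (fun z => (x <= z)%R) X)%N.
  rewrite -count_predUI [X in (_ + X)%N](_ : _ = 0%N) ?addn0; last first.
    apply/eqP; rewrite -leqn0 leqNgt -has_count; apply/hasPn => z _ /=.
    by case: ltP.
  symmetry; rewrite (eq_count (a2 := predT)) ?count_predT // => z /=.
  by case: ltP.
rewrite -[X in (X < _)%N]addn0 ltn_add2l -has_count; apply/hasP; exists x => //=.
Qed.

Lemma sum_rank_gap (X : {fset R}) (x : R) : x \in X ->
  \sum_(y <- X | x < y) ((rank X y)%:R - (rank X x)%:R)^-1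
    <= harmonic_sum #|` X|%fset.
Proof.
move=> xX; rewrite /harmonic_sum.
apply: (@ler_sum_inj _ _ _ _ _ (fun y => (rank X y - rank X x).-1)).
- exact: fset_uniq.
- move=> y yX xy; rewrite mem_index_iota /=.
  apply: leq_ltn_trans (rank_le_card yX).
  exact: leq_trans (leq_pred _) (leq_subr _ _).
- move=> y z yX zX xy xz e; have := rank_lt xX xy; have := rank_lt xX xz => h1 h2.
  have e' : rank X y = rank X z.
    by move: (rank X y) (rank X z) (rank X x) h1 h2 e => a b c; lia.
  by case: (ltgtP y z) => // /rank_lt; [move=> /(_ _ yX)|move=> /(_ _ zX)]; rewrite e' ltnn.
- move=> y yX xy; have h := rank_lt xX xy.
  by rewrite prednK ?subn_gt0 // natrB // ltnW.
- by move=> j _; rewrite invr_ge0 ler0n.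
Qed.

Definition incidences (X Y : {fset R}) (l : R * R) : R :=
  \sum_(x <- X) (l.1 * x + l.2 \in Y)%:R.

Lemma incidences_ge0 X Y l : 0 <= incidences X Y l.
Proof. by apply: sumr_ge0 => x _; rewrite ler0n. Qed.

(** A line of positive slope meets the grid in a chain increasing in both ranks, to which
    [sum_inv_chain] applies. The chain has one step less than points, whence the shift by 1; a line
    without points gives a negative cube. *)
Lemma line_third_moment (X Y : {fset R}) (l : R * R) : 0 < l.1 ->
  (incidences X Y l - 1) ^+ 3 <= (#|` X|%fset)%:R * (#|` Y|%fset)%:R *
   \sum_(a <- X) \sum_(b <- X | [&& a < b, l.1 * a + l.2 \in Y & l.1 * b + l.2 \in Y])
     ((rank X b)%:R - (rank X a)%:R)^-1
     * ((rank Y (l.1 * b + l.2))%:R - (rank Y (l.1 * a + l.2))%:R)^-1.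
Proof.
case: l => m c /= m0.
pose on x := m * x + c \in Y.
pose f x : R := (rank X x)%:R; pose g x : R := (rank Y (m * x + c))%:R.
have fmono a b : a \in X -> a < b -> f a < f b by move=> aX ab; rewrite ltr_nat rank_lt.
have gmono a b : on a -> a < b -> g a < g b.
  by move=> aX ab; rewrite ltr_nat rank_lt // ltrD2r ltr_pM2l.
set T := (X in _ <= _ * X).
have T0 : 0 <= T.
  rewrite /T big_seq; apply: sumr_ge0 => a aX; apply: sumr_ge0 => b /and3P[ab ona onb].
  by rewrite mulr_ge0 // invr_ge0 subr_ge0 ltW //; [exact: fmono|exact: gmono].
pose s := sort <=%R [seq x <- enum_fset X | on x].
have ps : perm_eq s [seq x <- enum_fset X | on x] by rewrite perm_sort.
have sX x : x \in s -> (x \in X) && on x.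
  by rewrite (perm_mem ps) mem_filter andbC.
have inc_s : incidences X Y (m, c) = (size s)%:R.
  rewrite (perm_size ps) size_filter /incidences -sum1_count natr_sum.
  rewrite [RHS]big_mkcond; apply: eq_bigr => x _ /=; rewrite /on.
  by case: ifP.
have ssort : sorted <%R s by rewrite sort_lt_sorted filter_uniq // fset_uniq.
rewrite inc_s.
have nX0 : 0 <= (#|` X|%fset)%:R :> R by rewrite ler0n.
have nY0 : 0 <= (#|` Y|%fset)%:R :> R by rewrite ler0n.
case es : s => [|x t] /=.
  by apply: (@le_trans _ _ 0); [rewrite exprn_odd_le0 //; lra|rewrite !mulr_ge0].
rewrite -natr1 addrK.
have [->|tn0] := posnP (size t); first by rewrite expr0n /= !mulr_ge0.
have k0 : 0 < (size t)%:R :> R by rewrite ltr0n.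
have xs : x \in s by rewrite es mem_head.
have ls : last x t \in s by rewrite es mem_last.
have [/andP[xX onx] /andP[lX onl]] := (sX _ xs, sX _ ls).
have X0 : 0 < (#|` X|%fset)%:R :> R.
  by rewrite ltr0n; case: #|` X|%fset (rank_le_card xX).
have Y0 : 0 < (#|` Y|%fset)%:R :> R.
  by rewrite ltr0n; case: #|` Y|%fset (rank_le_card onx).
have pt : path (fun a b => (f a < f b) && (g a < g b)) x t.
  have := ssort; rewrite es /=.
  apply: (@sub_in_path _ (mem s)); last by apply/allP => y; rewrite -es.
  move=> a b /= /sX/andP[aX ona] _ ab.
  by rewrite fmono // gmono.
(* With k = [size t] steps, [U] and [V] are the mean gaps of a chain that crosses the whole grid.
   The ranks rise by at most |X| and |Y| in all, so the numerator is at least k(3 - 1 - 1) and the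
   quotient at least k^3 / (|X||Y|). *)
have := @sum_inv_chain _ f g ((#|` X|%fset)%:R / (size t)%:R)
  ((#|` Y|%fset)%:R / (size t)%:R) x t (divr_gt0 X0 k0) (divr_gt0 Y0 k0) pt.
rewrite -es (perm_big _ ps) big_filter /=.
set S := (X in _ <= X) => chain.
have SR : S <= T.
  rewrite /S big_mkcond; apply: ler_sum_seq => a aX _.
  case: ifP => ona; last first.
    rewrite big_pred0 //; move=> b; rewrite /on in ona.
    by rewrite ona andbF.
  rewrite (perm_big _ ps) big_filter_cond /= big_mkcond [leRHS]big_mkcond.
  apply: ler_sum_seq => b bX _; rewrite -!/(on _) ona /=.
  case: (boolP (on b)) => onb /=; last by rewrite andbF.
  rewrite andbT; case: (ltrP a b) => ab.
    by rewrite fmono // gmono // invfM.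
  suff -> : (f a < f b) = false by [].
  apply/negbTE; rewrite -leNgt; move: ab; rewrite le_eqVlt => /orP[/eqP->//|ba].
  by rewrite ltW // fmono.
apply: le_trans (ler_wpM2l (mulr_ge0 nX0 nY0) (le_trans chain SR)).
have fl : f (last x t) - f x <= (#|` X|%fset)%:R.
  by rewrite lerBlDr (le_trans (y := #|` X|%fset%:R)) ?lerDl ?ler0n // ler_nat ltnW // rank_le_card.
have gl : g (last x t) - g x <= (#|` Y|%fset)%:R.
  by rewrite lerBlDr (le_trans (y := #|` Y|%fset%:R)) ?lerDl ?ler0n // ler_nat ltnW // rank_le_card.
set nX := (#|` X|%fset)%:R in X0 fl *; set nY := (#|` Y|%fset)%:R in Y0 gl *.
set k := (size t)%:R in k0 *.
set u := f _ - f x in fl *; set v := g _ - g x in gl *.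
have -> : nX * nY * ((k * 3 - u / (nX / k) - v / (nY / k)) / (nX / k * (nY / k)))
  = k ^+ 3 * (3 - u / nX - v / nY) by field; rewrite !gt_eqF.
rewrite -[leLHS]mulr1 ler_wpM2l ?exprn_ge0 ?(ltW k0) //.
have : u / nX <= 1 by rewrite ler_pdivrMr // mul1r.
have : v / nY <= 1 by rewrite ler_pdivrMr // mul1r.
lra.
Qed.

(* The Szemeredi-Trotter bound for the grid [X x Y], as a third moment.
   A pair of grid points lies on at most one line, and weighting it by the
   inverse product of its rank distances makes the lines of [k] points collect
   weight at least [(k-1)^3 / (|X||Y|)]. *)
Lemma grid_third_moment (X Y : {fset R}) (L : seq (R * R)) :
  uniq L -> (forall l, l \in L -> 0 < l.1) ->
  \sum_(l <- L) (incidences X Y l - 1) ^+ 3 <=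
  (#|` X|%fset)%:R ^+ 2 * (#|` Y|%fset)%:R ^+ 2
    * (harmonic_sum #|` X|%fset * harmonic_sum #|` Y|%fset).
Proof.
move=> uL Lpos.
set nX := (#|` X|%fset)%:R; set nY := (#|` Y|%fset)%:R.
set hX := harmonic_sum _; set hY := harmonic_sum _.
pose wX (a b : R) : R := ((rank X b)%:R - (rank X a)%:R)^-1.
pose wY (a b : R) : R := ((rank Y b)%:R - (rank Y a)%:R)^-1.
have wX0 a b : a \in X -> a < b -> 0 <= wX a b.
  by move=> aX ab; rewrite invr_ge0 subr_ge0 ler_nat ltnW // rank_lt.
have wY0 a b : a \in Y -> a < b -> 0 <= wY a b.
  by move=> aX ab; rewrite invr_ge0 subr_ge0 ler_nat ltnW // rank_lt.
have gap (Z : {fset R}) (w : R -> R -> R) :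
  (forall x, x \in Z -> \sum_(y <- Z | x < y) w x y <= harmonic_sum #|` Z|%fset) ->
  \sum_(a <- Z) \sum_(b <- Z | a < b) w a b <= (#|` Z|%fset)%:R * harmonic_sum #|` Z|%fset.
  move=> Zw; apply: (@le_trans _ _ (\sum_(a <- Z) harmonic_sum #|` Z|%fset)).
    by apply: ler_sum_seq => a aZ _; apply: Zw.
  by rewrite big_const_seq count_predT iter_addr addr0 mulr_natl.
have gX : \sum_(a <- X) \sum_(b <- X | a < b) wX a b <= nX * hX.
  by apply: gap => x; apply: sum_rank_gap.
have gY : \sum_(a <- Y) \sum_(b <- Y | a < b) wY a b <= nY * hY.
  by apply: gap => x; apply: sum_rank_gap.
apply: (@le_trans _ _ (\sum_(l <- L) (nX * nY *
   \sum_(a <- X) \sum_(b <- X | [&& a < b, l.1 * a + l.2 \in Y & l.1 * b + l.2 \in Y])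
     wX a b * wY (l.1 * a + l.2) (l.1 * b + l.2)))).
  by apply: ler_sum_seq => l lL _; apply: line_third_moment; apply: Lpos.
rewrite -mulr_sumr exchange_big /=.
have -> : nX ^+ 2 * nY ^+ 2 * (hX * hY) = nX * nY * ((nX * hX) * (nY * hY)) by ring.
apply: ler_wpM2l; first by rewrite mulr_ge0 // ler0n.
apply: (@le_trans _ _ ((\sum_(a <- X) \sum_(b <- X | a < b) wX a b)
   * (\sum_(a <- Y) \sum_(b <- Y | a < b) wY a b))); last first.
  apply: ler_pM => //.
    by rewrite big_seq; apply: sumr_ge0 => a aX; apply: sumr_ge0 => b; apply: wX0.
  by rewrite big_seq; apply: sumr_ge0 => a aX; apply: sumr_ge0 => b; apply: wY0.
rewrite mulr_suml; apply: ler_sum_seq => a aX _.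
rewrite mulr_suml.
under eq_bigr => l _ do rewrite big_mkcond.
rewrite exchange_big /= [leRHS]big_mkcond.
apply: ler_sum_seq => b bX _; case: ifP => ab /=; last by rewrite big1.
rewrite -big_mkcond -mulr_sumr ler_wpM2l ?wX0 //.
have -> : \sum_(a <- Y) \sum_(b <- Y | a < b) wY a b =
   \sum_(p <- [seq (y, z) | y <- Y, z <- Y]) (if p.1 < p.2 then wY p.1 p.2 else 0).
  by rewrite big_allpairs /=; apply: eq_bigr => y _; rewrite big_mkcond.
apply: (@ler_sum_inj _ _ _ _ _
  (fun l : R * R => (l.1 * a + l.2, l.1 * b + l.2))) => /=.
- exact: uL.
- by move=> l lL /andP[ya yb]; apply/allpairsP; exists (l.1 * a + l.2, l.1 * b + l.2).
- move=> [m c] [m' c'] _ _ _ _ /= [e1 e2].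
  have : (m - m') * (a - b) = 0 by lra.
  move/eqP; rewrite mulf_eq0 !subr_eq0 (lt_eqF ab) orbF => /eqP em.
  by move: e1; rewrite em => /addrI ->.
- by move=> l lL _; rewrite ltrD2r ltr_pM2l ?ab // Lpos.
- move=> p /allpairsP[[y z] /= [yY zY ->]] /=; case: ifP => // yz; exact: wY0.
Qed.

End Grids.

(** * Hoelder inequalities and cubes of incidence counts *)

Section Moments.
Variable R : realFieldType.

(** The hypothesis [F i ^+ 2 <= x i * y i], and its cubic analogue in [holder3], replace the usual
    factors with fractional powers, as an ordered field need not contain roots. *)
Lemma holder2 (I : eqType) (s : seq I) (F x y : I -> R) :
  (forall i, i \in s -> [/\ 0 <= x i, 0 <= y i & F i ^+ 2 <= x i * y i]) ->
  (\sum_(i <- s) F i) ^+ 2 <= (\sum_(i <- s) x i) * (\sum_(i <- s) y i).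
Proof.
elim: s => [|i s IH] H; first by rewrite !big_nil expr0n mul0r.
rewrite !big_cons.
have [x0 y0 xy] := H i (mem_head i s).
have Hs j : j \in s -> [/\ 0 <= x j, 0 <= y j & F j ^+ 2 <= x j * y j].
  by move=> js; apply: H; rewrite in_cons js orbT.
have X0 : 0 <= \sum_(j <- s) x j by rewrite big_seq sumr_ge0 // => j /Hs[].
have Y0 : 0 <= \sum_(j <- s) y j by rewrite big_seq sumr_ge0 // => j /Hs[].
move: (IH Hs) X0 Y0.
set G := \sum_(j <- s) F j; set X := \sum_(j <- s) x j; set Y := \sum_(j <- s) y j.
move: (F i) (x i) (y i) G X Y x0 y0 xy => f a b G X Y a0 b0 fab GXY X0 Y0.
suff : 2 * (f * G) <= a * Y + X * b by nra.
apply: le_trans (ler_norm _) _.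
have p0 : 0 <= a * Y + X * b by rewrite addr_ge0 ?mulr_ge0.
rewrite -ler_sqr ?nnegrE // -normrX ger0_norm ?sqr_ge0 //.
have := ler_pM (sqr_ge0 f) (sqr_ge0 G) fab GXY.
have := sqr_ge0 (a * Y - X * b).
nra.
Qed.

Lemma amgm3_cube (p q r t : R) : 0 <= p -> 0 <= q -> 0 <= r ->
  t ^+ 3 <= p * q * r -> 3 * t <= p + q + r.
Proof.
move=> p0 q0 r0 tpqr; rewrite leNgt; apply/negP => lt.
have s0 : 0 <= p + q + r by rewrite !addr_ge0.
have : (p + q + r) ^+ 3 < (3 * t) ^+ 3.
  by rewrite ltrXn2r // ltW // (le_lt_trans s0).
rewrite ltNge => /negP; apply.
have e1 : 0 <= p * (q - r) ^+ 2 by rewrite mulr_ge0 ?sqr_ge0.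
have e2 : 0 <= q * (p - r) ^+ 2 by rewrite mulr_ge0 ?sqr_ge0.
have e3 : 0 <= r * (p - q) ^+ 2 by rewrite mulr_ge0 ?sqr_ge0.
have e4 : 0 <= (p + q + r) * ((p - q) ^+ 2 + (p - r) ^+ 2 + (q - r) ^+ 2).
  by rewrite mulr_ge0 ?addr_ge0 ?sqr_ge0.
rewrite exprMn.
lra.
Qed.

Lemma holder3 (I : eqType) (s : seq I) (F x y z : I -> R) :
  (forall i, i \in s ->
     [/\ 0 <= F i, 0 <= x i, 0 <= y i, 0 <= z i & F i ^+ 3 <= x i * y i * z i]) ->
  (\sum_(i <- s) F i) ^+ 3 <=
    (\sum_(i <- s) x i) * (\sum_(i <- s) y i) * (\sum_(i <- s) z i).
Proof.
elim: s => [|i s IH] H; first by rewrite !big_nil expr0n !mul0r.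
rewrite !big_cons.
have [f0 x0 y0 z0 xyz] := H i (mem_head i s).
have Hs j : j \in s ->
    [/\ 0 <= F j, 0 <= x j, 0 <= y j, 0 <= z j & F j ^+ 3 <= x j * y j * z j].
  by move=> js; apply: H; rewrite in_cons js orbT.
have G0 : 0 <= \sum_(j <- s) F j by rewrite big_seq sumr_ge0 // => j /Hs[].
have X0 : 0 <= \sum_(j <- s) x j by rewrite big_seq sumr_ge0 // => j /Hs[].
have Y0 : 0 <= \sum_(j <- s) y j by rewrite big_seq sumr_ge0 // => j /Hs[].
have Z0 : 0 <= \sum_(j <- s) z j by rewrite big_seq sumr_ge0 // => j /Hs[].
move: (IH Hs) G0 X0 Y0 Z0.
set G := \sum_(j <- s) F j; set X := \sum_(j <- s) x j.
set Y := \sum_(j <- s) y j; set Z := \sum_(j <- s) z j.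
move: (F i) (x i) (y i) (z i) G X Y Z f0 x0 y0 z0 xyz.
move=> f a b c G X Y Z f0 a0 b0 c0 fabc GXYZ G0 X0 Y0 Z0.
(* The mixed terms of (f + G)^3 are compared with those of (a + X)(b + Y)(c + Z). AM-GM applies
   because the product of the three terms on the right is (abc)^2 XYZ here and abc (XYZ)^2 in
   [h2]. *)
have h1 : 3 * (f ^+ 2 * G) <= a * b * Z + a * Y * c + X * b * c.
  apply: amgm3_cube; rewrite ?mulr_ge0 //.
  have -> : a * b * Z * (a * Y * c) * (X * b * c) = (a * b * c) ^+ 2 * (X * Y * Z) by ring.
  rewrite exprMn ler_pM ?exprn_ge0 // -exprM mulnC exprM.
  by rewrite ler_sqr ?nnegrE ?exprn_ge0 ?mulr_ge0.
have h2 : 3 * (f * G ^+ 2) <= a * Y * Z + X * b * Z + X * Y * c.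
  apply: amgm3_cube; rewrite ?mulr_ge0 //.
  have -> : a * Y * Z * (X * b * Z) * (X * Y * c) = (a * b * c) * (X * Y * Z) ^+ 2 by ring.
  rewrite exprMn ler_pM ?exprn_ge0 // -exprM mulnC exprM.
  by rewrite ler_sqr ?nnegrE ?exprn_ge0 ?mulr_ge0.
lra.
Qed.

Lemma sum_cube_le (I : eqType) (s : seq I) (f : I -> R) :
  (forall i, 0 <= f i) ->
  (\sum_(i <- s) f i) ^+ 3 <= (size s)%:R ^+ 2 * \sum_(i <- s) f i ^+ 3.
Proof.
move=> f0.
have -> : (size s)%:R = \sum_(i <- s) 1 :> R.
  by rewrite big_const_seq count_predT iter_addr addr0.
rewrite expr2; apply: holder3 => i _.
by rewrite !ler01 f0 exprn_ge0 // !mul1r.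
Qed.

Lemma incidences_nat (X Y : {fset R}) (l : R * R) :
  incidences X Y l = (count (fun x => l.1 * x + l.2 \in Y) X)%:R.
Proof.
rewrite /incidences -sum1_count natr_sum [RHS]big_mkcond.
by apply: eq_bigr => x _ /=; case: ifP.
Qed.

(** For natural i >= 1 one has i^3 <= 8 (i - 1)^3 + i: equality at 1, and i <= 2 (i - 1) from 2 on.
    It fails at 0, so empty lines are removed before the grid bound is used. *)
Lemma sum_incidences_cube (X Y : {fset R}) (L : seq (R * R)) :
  uniq L -> (forall l, l \in L -> 0 < l.1) ->
  \sum_(l <- L) incidences X Y l ^+ 3 <=
  8 * ((#|` X|%fset)%:R ^+ 2 * (#|` Y|%fset)%:R ^+ 2
    * (harmonic_sum R #|` X|%fset * harmonic_sum R #|` Y|%fset))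
  + \sum_(l <- L) incidences X Y l.
Proof.
move=> uL Lpos.
pose L' := [seq l <- L | incidences X Y l != 0].
have L'L l : l \in L' -> incidences X Y l != 0 /\ l \in L.
  by rewrite mem_filter => /andP[].
apply: (@le_trans _ _ (\sum_(l <- L') incidences X Y l ^+ 3)).
  rewrite big_filter [leRHS]big_mkcond; apply: ler_sum => l _.
  by case: eqP => //= ->; rewrite expr0n.
apply: (@le_trans _ _ (\sum_(l <- L')
   (8 * (incidences X Y l - 1) ^+ 3 + incidences X Y l))).
  apply: ler_sum_seq => l /L'L[+ _]; rewrite incidences_nat.
  case: count => [|[|k]]; first by rewrite mulr0n eqxx.
    by move=> _ _; rewrite subrr expr0n mulr0 add0r expr1n.
  move=> _ _; rewrite -[k.+2]addn1 natrD addrK.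
  have k0 : 1 <= (k.+1)%:R :> R by rewrite ler1n.
  set a : R := _%:R in k0 *.
  have : (a + 1) ^+ 3 <= (2 * a) ^+ 3 by rewrite lerXn2r ?nnegrE //; lra.
  rewrite exprMn; lra.
rewrite big_split /= -mulr_sumr; apply: lerD.
  by apply: ler_wpM2l => //; apply: grid_third_moment => [|l /L'L[_ /Lpos]//]; rewrite filter_uniq.
rewrite big_filter [leLHS]big_mkcond; apply: ler_sum => l _.
by case: ifP => // _; apply: incidences_ge0.
Qed.

Lemma sum_incidences_cube_rich (X Y : {fset R}) (L : seq (R * R)) :
  uniq L -> (forall l, l \in L -> 0 < l.1 /\ 2 <= incidences X Y l) ->
  \sum_(l <- L) incidences X Y l ^+ 3 <=
  8 * ((#|` X|%fset)%:R ^+ 2 * (#|` Y|%fset)%:R ^+ 2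
    * (harmonic_sum R #|` X|%fset * harmonic_sum R #|` Y|%fset)).
Proof.
move=> uL LH.
apply: (@le_trans _ _ (\sum_(l <- L) (8 * (incidences X Y l - 1) ^+ 3))).
  apply: ler_sum_seq => l /LH[_ h] _.
  set a := incidences X Y l in h *.
  have : a ^+ 3 <= (2 * (a - 1)) ^+ 3 by rewrite lerXn2r ?nnegrE //; lra.
  by rewrite exprMn; lra.
rewrite -mulr_sumr; apply: ler_wpM2l => //.
by apply: grid_third_moment => // l /LH[].
Qed.
End Moments.

(** * Differences of sets with many dilates *)

Section DifferenceRepresentations.
Variable R : realFieldType.

Definition dif_reps (U V : {fset R}) (f : R) : R := \sum_(u <- U) (u - f \in V)%:R.

Lemma dif_reps_ge0 U V f : 0 <= dif_reps U V f.
Proof. by apply: sumr_ge0 => u _; rewrite ler0n. Qed.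

Lemma sum_nat_le_size (I : eqType) (s : seq I) (P : pred I) :
  \sum_(i <- s) (P i)%:R <= (size s)%:R :> R.
Proof.
rewrite -sum1_size natr_sum; apply: ler_sum => i _.
by rewrite ler_nat leq_b1.
Qed.

Lemma sum_nat_inj_le_size (I J : eqType) (s : seq I) (t : seq J) (h : I -> J) :
  uniq s -> {in s &, injective h} ->
  \sum_(i <- s) (h i \in t)%:R <= (size t)%:R :> R.
Proof.
move=> us hinj; have -> : (size t)%:R = \sum_(j <- t) 1 :> R.
  by rewrite big_const_seq count_predT iter_addr addr0.
have -> : \sum_(i <- s) (h i \in t)%:R = \sum_(i <- s | h i \in t) 1 :> R.
  by rewrite [RHS]big_mkcond; apply: eq_bigr => i _; case: ifP.
by apply: (@ler_sum_inj _ _ _ _ _ _ h) => // i j si sj _ _; apply: hinj.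
Qed.

Section Dilates.
Variables (D V W F : {fset R}) (g : R -> R).
Hypothesis g_gt0 : forall w, w \in W -> 0 < g w.
Hypothesis g_inj : {in W &, injective g}.

Lemma sum_dilates_incidences :
  \sum_(f <- F) \sum_(w <- W) incidences D V (g w, - f)
   <= (#|` W|%fset)%:R * (#|` D|%fset)%:R * (#|` V|%fset)%:R.
Proof.
rewrite exchange_big /=.
apply: (@le_trans _ _ (\sum_(w <- W) \sum_(x <- D) (#|` V|%fset)%:R)).
  apply: ler_sum => w _; rewrite exchange_big /=; apply: ler_sum => x _.
  apply: sum_nat_inj_le_size; first exact: fset_uniq.
  by move=> a b _ _ /addrI /oppr_inj.
by rewrite !big_const_seq !count_predT !iter_addr !addr0 -mulrA !mulr_natl.
Qed.

Lemma sum_dilates_incidences_cube :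
  \sum_(f <- F) \sum_(w <- W) incidences D V (g w, - f) ^+ 3
   <= 8 * ((#|` D|%fset)%:R ^+ 2 * (#|` V|%fset)%:R ^+ 2
    * (harmonic_sum R #|` D|%fset * harmonic_sum R #|` V|%fset))
    + (#|` W|%fset)%:R * (#|` D|%fset)%:R * (#|` V|%fset)%:R.
Proof.
pose L := [seq (g w, - f) | f <- F, w <- W].
have sumL (G : R * R -> R) : \sum_(f <- F) \sum_(w <- W) G (g w, - f) = \sum_(l <- L) G l.
  by rewrite big_allpairs_dep.
rewrite (sumL (fun l => incidences D V l ^+ 3)).
apply: le_trans (sum_incidences_cube _ _ _ _) _.
- apply: allpairs_uniq; try exact: fset_uniq.
  move=> [f w] [f' w'] /allpairsP[[? ?] /= [_ wW [_ ->]]] /allpairsP[[? ?] /= [_ wW' [_ ->]]].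
  by move=> [/g_inj ->// /oppr_inj ->].
- by move=> l /allpairsP[[f w] /= [_ wW ->]]; apply: g_gt0.
by rewrite lerD2l -sumL sum_dilates_incidences.
Qed.

Variables (U : {fset R}) (d : R).
Hypothesis d_ge0 : 0 <= d.
Hypothesis U_rich : forall u, u \in U -> d <= \sum_(w <- W) (u / g w \in D)%:R.

(** If u = g(w) x with x in [D], then u - v = f says that (x, v) lies on the line of slope g(w) and
    intercept -f. Each representation of f thus yields at least [d] incidences with the grid [D] x
    [V]. *)
Lemma dif_reps_dilates f :
  d * dif_reps U V f <= \sum_(w <- W) incidences D V (g w, - f).
Proof.
rewrite mulr_sumr.
apply: (@le_trans _ _ (\sum_(u <- U) \sum_(w <- W) ((u / g w \in D) && (u - f \in V))%:R)).
  apply: ler_sum_seq => u uU _; case: (u - f \in V); last first.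
    by rewrite mulr0 sumr_ge0 // => w _; rewrite ler0n.
  by rewrite mulr1; under eq_bigr do rewrite andbT; apply: U_rich.
rewrite exchange_big /=; apply: ler_sum_seq => w wW _.
have -> : \sum_(u <- U) ((u / g w \in D) && (u - f \in V))%:R =
   \sum_(u <- U | u / g w \in D) (u - f \in V)%:R :> R.
  by rewrite [RHS]big_mkcond; apply: eq_bigr => u _; case: ifP.
have gw0 : g w != 0 by rewrite gt_eqF // g_gt0.
apply: (@ler_sum_inj _ _ _ _ _ _ (fun u => u / g w)) => //=; try exact: fset_uniq.
- by move=> u v _ _ _ _ /mulIf; apply; rewrite invr_eq0.
- by move=> u _ _; rewrite mulrC divfK.
Qed.

(** The power mean inequality over [W] costs |W|^2; the lines (g w, -f) are distinct for distinct
    (f, w), so one grid bound serves all f together. *)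
Lemma dif_reps_third_moment :
  d ^+ 3 * \sum_(f <- F) dif_reps U V f ^+ 3 <= (#|` W|%fset)%:R ^+ 2 *
   (8 * ((#|` D|%fset)%:R ^+ 2 * (#|` V|%fset)%:R ^+ 2
    * (harmonic_sum R #|` D|%fset * harmonic_sum R #|` V|%fset))
    + (#|` W|%fset)%:R * (#|` D|%fset)%:R * (#|` V|%fset)%:R).
Proof.
apply: le_trans (ler_wpM2l (exprn_ge0 2 (ler0n _ _)) sum_dilates_incidences_cube).
rewrite !mulr_sumr; apply: ler_sum => f _; rewrite -exprMn.
apply: le_trans (sum_cube_le _ _); last by move=> w; apply: incidences_ge0.
rewrite lerXn2r ?nnegrE ?dif_reps_dilates //.
  by rewrite mulr_ge0 // dif_reps_ge0.
by apply: sumr_ge0 => w _; apply: incidences_ge0.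
Qed.

(** The second incidence moment is interpolated between the first, which is counted trivially, and
    the third: I2^2 <= I1 I3. *)
Lemma dif_reps_second_moment :
  (d ^+ 2 * \sum_(f <- F) dif_reps U V f ^+ 2) ^+ 2 <= (#|` W|%fset)%:R ^+ 2 *
   ((#|` W|%fset)%:R * (#|` D|%fset)%:R * (#|` V|%fset)%:R) *
   (8 * ((#|` D|%fset)%:R ^+ 2 * (#|` V|%fset)%:R ^+ 2
    * (harmonic_sum R #|` D|%fset * harmonic_sum R #|` V|%fset))
    + (#|` W|%fset)%:R * (#|` D|%fset)%:R * (#|` V|%fset)%:R).
Proof.
set I1 := \sum_(f <- F) \sum_(w <- W) incidences D V (g w, - f).
set I2 := \sum_(f <- F) \sum_(w <- W) incidences D V (g w, - f) ^+ 2.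
set I3 := \sum_(f <- F) \sum_(w <- W) incidences D V (g w, - f) ^+ 3.
have i0 l : 0 <= incidences D V l by apply: incidences_ge0.
have h12 : I2 ^+ 2 <= I1 * I3.
  rewrite /I1 /I2 /I3; apply: holder2 => f _; split.
  - by apply: sumr_ge0.
  - by apply: sumr_ge0 => w _; rewrite exprn_ge0.
  - apply: holder2 => w _; split=> //; first by rewrite exprn_ge0.
    by rewrite -exprM -exprS.
have h2 : d ^+ 2 * \sum_(f <- F) dif_reps U V f ^+ 2 <= (#|` W|%fset)%:R * I2.
  rewrite !mulr_sumr; apply: ler_sum => f _; rewrite -exprMn.
  apply: le_trans (sum_sq_le _ _).
  rewrite lerXn2r ?nnegrE ?dif_reps_dilates //.
    by rewrite mulr_ge0 // dif_reps_ge0.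
  by apply: sumr_ge0.
have I10 : 0 <= I1 by apply: sumr_ge0 => f _; apply: sumr_ge0.
have I30 : 0 <= I3 by apply: sumr_ge0 => f _; apply: sumr_ge0 => w _; rewrite exprn_ge0.
have I20 : 0 <= I2 by apply: sumr_ge0 => f _; apply: sumr_ge0 => w _; rewrite exprn_ge0.
apply: (@le_trans _ _ (((#|` W|%fset)%:R * I2) ^+ 2)).
  rewrite lerXn2r ?nnegrE //; last by rewrite mulr_ge0.
  by rewrite mulr_ge0 ?exprn_ge0 // sumr_ge0 // => f _; rewrite exprn_ge0 // dif_reps_ge0.
rewrite exprMn -mulrA ler_wpM2l ?exprn_ge0 ?ler0n //.
apply: le_trans h12 _; apply: ler_pM => //.
  exact: sum_dilates_incidences.
exact: sum_dilates_incidences_cube.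
Qed.

End Dilates.
End DifferenceRepresentations.

(** * Quotients, products and energies *)

Section Quotients.
Variable R : realFieldType.

(** The functions N(m) and, below, rat(m) of the overview. The last element of each triple or pair
    is determined by m and the others, so membership replaces a division. *)
Definition shift_quot_reps (A : {fset R}) (m : R) : R :=
  \sum_(a <- A) \sum_(y <- A) (m * (y + a) - a \in A)%:R.

Definition quot_reps (A : {fset R}) (m : R) : R := \sum_(x <- A) (m * x \in A)%:R.

Definition prod_reps (A : {fset R}) (t : R) : R := \sum_(x <- A) (t / x \in A)%:R.

Lemma shift_quot_reps_ge0 A m : 0 <= shift_quot_reps A m.
Proof. by apply: sumr_ge0 => a _; apply: sumr_ge0 => y _; rewrite ler0n. Qed.

Lemma quot_reps_ge0 A m : 0 <= quot_reps A m.
Proof. by apply: sumr_ge0 => a _; rewrite ler0n. Qed.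

Lemma quot_reps_le A m : quot_reps A m <= (#|` A|%fset)%:R.
Proof. exact: sum_nat_le_size. Qed.

(* (y + a)/(y' + a) = (z + b)/(z' + b) if and only if (-a,-b), (y,z) and (y',z')
   are collinear. *)
Lemma shift_quot_second_moment (A : {fset R}) (M : seq R) :
  (forall x, x \in A -> 0 < x) -> uniq M ->
  \sum_(m <- M) shift_quot_reps A m ^+ 2 <=
    128 * (#|` A|%fset)%:R ^+ 4 * harmonic_sum R (2 * #|` A|%fset) ^+ 2.
Proof.
move=> A0 uM.
(* A single grid [X] x [X] must contain the points (-a,-b) as well as (y,z); 128 is 8 * 2^4 because
   |X| <= 2|A|. *)
pose X : {fset R} := (A `|` [fset - x | x in A])%fset.
have AX x : x \in A -> x \in X by move=> xA; rewrite in_fsetU xA.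
have NAX x : x \in A -> - x \in X.
  by move=> xA; rewrite in_fsetU; apply/orP; right; apply/imfsetP; exists x.
have cX : (#|` X|%fset <= 2 * #|` A|%fset)%N.
  apply: leq_trans (_ : #|` A|%fset + #|` [fset - x | x in A]|%fset <= _)%N.
    by rewrite cardfsU leq_subr.
  by rewrite mul2n -addnn leq_add2l leq_imfset_card.
pose P := [seq (a, y) | a <- enum_fset A, y <- enum_fset A].
pose T := [seq (p, q) | p <- P, q <- P].
have PA p : p \in P -> p.1 \in A /\ p.2 \in A.
  by case/allpairsP => [[a y]] /= [aA yA ->].
have uP : uniq P.
  by apply: allpairs_uniq; rewrite ?fset_uniq // => -[a y] [a' y'] _ _ /= [-> ->].
have uT : uniq T.
  by apply: allpairs_uniq => // -[a y] [a' y'] _ _ /= [-> ->].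
pose on m (p : R * R) := m * (p.2 + p.1) - p.1 \in A.
(* For r = ((a,y),(b,z)) this is the line through (-a,-b) and (y,z). Each common ratio m places a
   third grid point on it, and different m give different points. *)
pose l (r : (R * R) * (R * R)) : R * R :=
  let mu := (r.2.2 + r.2.1) / (r.1.2 + r.1.1) in (mu, mu * r.1.1 - r.2.1).
have on_l m r : r \in T -> m * (r.1.2 + r.1.1) - r.1.1 \in A -> on m r.2 ->
    (l r).1 * (m * (r.1.2 + r.1.1) - r.1.1) + (l r).2 \in X.
  case: r => -[a y] [b z] /allpairsP[[p q] /= [/PA[aA yA] /PA[bA zA]]] /= [e1 e2].
  rewrite -e1 -e2 /= in aA yA bA zA.
  rewrite /on /= => _ onz; apply: AX.
  rewrite [X in X \in _](_ : _ = m * (z + b) - b) // /l /=.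
  by field; rewrite gt_eqF // addr_gt0 ?A0.
have l_pos r : r \in T -> 0 < (l r).1.
  case/allpairsP => -[p q] /= [/PA[aA yA] /PA[bA zA]] -> /=.
  by rewrite divr_gt0 // addr_gt0 ?A0.
have l_a r : r \in T -> - r.1.1 \in X /\ (l r).1 * (- r.1.1) + (l r).2 = - r.2.1.
  case/allpairsP => -[p q] /= [/PA[aA yA] /PA[bA zA]] -> /=.
  by split; [exact: NAX|ring].
have l_y r : r \in T -> r.1.2 \in X /\ (l r).1 * r.1.2 + (l r).2 = r.2.2.
  case/allpairsP => -[p q] /= [/PA[aA yA] /PA[bA zA]] -> /=.
  split; first exact: AX.
  by field; rewrite gt_eqF // addr_gt0 ?A0.
have TA r : r \in T -> [/\ r.1.1 \in A, r.1.2 \in A, r.2.1 \in A & r.2.2 \in A].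
  by case/allpairsP => -[p q] /= [/PA[aA yA] /PA[bA zA]] ->.
pose L := undup [seq l r | r <- T].
have lL r : r \in T -> l r \in L by move=> rT; rewrite mem_undup; apply/mapP; exists r.
have step1 : \sum_(m <- M) shift_quot_reps A m ^+ 2 <= \sum_(r <- T) incidences X X (l r).
  have -> : \sum_(m <- M) shift_quot_reps A m ^+ 2 =
     \sum_(r <- T) \sum_(m <- M) (on m r.1 && on m r.2)%:R.
    rewrite exchange_big /=; apply: eq_bigr => m _.
    have -> : shift_quot_reps A m = \sum_(p <- P) (on m p)%:R by rewrite big_allpairs.
    rewrite expr2 big_distrlr [RHS]big_allpairs /=; apply: eq_bigr => p _.
    by apply: eq_bigr => q _; rewrite -natrM mulnb.
  apply: ler_sum_seq => r rT _.
  have -> : \sum_(m <- M) (on m r.1 && on m r.2)%:R =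
     \sum_(m <- M | on m r.1 && on m r.2) 1 :> R.
    by rewrite [RHS]big_mkcond; apply: eq_bigr => m _; case: ifP.
  have [aA yA _ _] := TA r rT.
  apply: (@ler_sum_inj _ _ _ _ _ _ (fun m => m * (r.1.2 + r.1.1) - r.1.1)) => //=.
  - by move=> m _ /andP[+ _]; apply: AX.
  - move=> m m' _ _ _ _ /addIr /mulIf; apply.
    by rewrite gt_eqF // addr_gt0 ?A0.
  - by move=> m _ /andP[on1 on2]; rewrite on_l.
apply: le_trans step1 _.
rewrite (sum_fiber _ (undup_uniq _) lL).
apply: (@le_trans _ _ (\sum_(k <- L) incidences X X k ^+ 3)).
  apply: ler_sum => k _; rewrite exprSr ler_wpM2r ?incidences_ge0 //.
  rewrite expr2 big_distrlr /=.
  have -> : \sum_(x <- X) \sum_(x' <- X)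
      (k.1 * x + k.2 \in X)%:R * (k.1 * x' + k.2 \in X)%:R =
    \sum_(p <- [seq (x, x') | x <- enum_fset X, x' <- enum_fset X])
      (k.1 * p.1 + k.2 \in X)%:R * (k.1 * p.2 + k.2 \in X)%:R :> R.
    by rewrite [RHS]big_allpairs.
  have -> : \sum_(r <- T) (l r == k)%:R = \sum_(r <- T | l r == k) 1 :> R.
    by rewrite [RHS]big_mkcond; apply: eq_bigr => m _; case: ifP.
  apply: (@ler_sum_inj _ _ _ _ _ _ (fun r => (- r.1.1, r.1.2))) => //=.
  - move=> r rT _; apply/allpairsP; exists (- r.1.1, r.1.2).
    by have [] := l_a r rT; have [] := l_y r rT.
  - move=> r r' rT rT' /eqP e /eqP e' [/oppr_inj ea ey].
    have [_ eb] := l_a r rT; have [_ eb'] := l_a r' rT'.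
    have [_ ez] := l_y r rT; have [_ ez'] := l_y r' rT'.
    move: eb eb' ez ez'; rewrite e e' -ea -ey => -> /oppr_inj eb -> ez.
    case: r r' ea ey eb ez {rT rT' e e'} => -[a y] [b z] [[a' y'] [b' z']] /=.
    by move=> -> -> -> ->.
  - move=> r rT /eqP e; have [_] := l_a r rT; have [_] := l_y r rT; rewrite e.
    have [aA yA bA zA] := TA r rT.
    by move=> -> ->; rewrite NAX // AX // mulr1.
(* The lines are rich because -a < 0 < y are two different abscissas. *)
apply: le_trans (sum_incidences_cube_rich (undup_uniq _) _) _.
  move=> k; rewrite mem_undup => /mapP[r rT ->]; split; first exact: l_pos.
  have [aA yA bA zA] := TA r rT.
  have [aX ea] := l_a r rT; have [yX ey] := l_y r rT.
  apply: (@le_trans _ _ (\sum_(x <- [:: - r.1.1; r.1.2]) ((l r).1 * x + (l r).2 \in X)%:R)).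
    by rewrite big_cons big_seq1 ea ey NAX // AX // -natrD.
  apply: ler_sum_sub => [|x|x _]; last by rewrite ler0n.
    rewrite /= inE andbT lt_eqF //; apply: lt_trans (A0 _ yA).
    by rewrite oppr_lt0 A0.
  by rewrite in_cons mem_seq1 => /orP[/eqP->|/eqP->].
have cXR : (#|` X|%fset)%:R <= 2 * (#|` A|%fset)%:R :> R by rewrite -natrM ler_nat.
have -> : 128 * (#|` A|%fset)%:R ^+ 4 * harmonic_sum R (2 * #|` A|%fset) ^+ 2
 = 8 * ((2 * (#|` A|%fset)%:R) ^+ 2 * (2 * (#|` A|%fset)%:R) ^+ 2
   * (harmonic_sum R (2 * #|` A|%fset) * harmonic_sum R (2 * #|` A|%fset))) by ring.
have hX := harmonic_sum_le R cX.
have h0 k : 0 <= harmonic_sum R k by apply: harmonic_sum_ge0.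
have sX : (#|` X|%fset)%:R ^+ 2 <= (2 * (#|` A|%fset)%:R) ^+ 2 :> R.
  by rewrite lerXn2r ?nnegrE ?mulr_ge0 ?ler0n.
rewrite ler_wpM2l // !ler_pM ?mulr_ge0 ?exprn_ge0 ?ler0n //.
Qed.

Lemma sum_eq_mem (I : eqType) (s : seq I) (a : I) :
  uniq s -> \sum_(i <- s) (a == i)%:R = (a \in s)%:R :> R.
Proof.
move=> us; rewrite -[RHS]mulr1 -(sum_indic a (fun=> 1) us).
by apply: eq_bigr => i _; rewrite mulr1.
Qed.

Lemma sum_quotients (A : {fset R}) (M : seq R) (F : R -> R) :
  (forall x, x \in A -> x != 0) -> uniq M ->
  (forall x y, x \in A -> y \in A -> x / y \in M) ->
  \sum_(x <- A) \sum_(y <- A) F (x / y) = \sum_(m <- M) quot_reps A m * F m.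
Proof.
move=> A0 uM AM; under [RHS]eq_bigr do rewrite mulr_suml.
rewrite exchange_big [RHS]exchange_big /= big_seq [RHS]big_seq.
apply: eq_bigr => y yA.
rewrite (sum_fiber (t := M) (h := fun x => x / y)) // => [|x xA]; last exact: AM.
apply: eq_bigr => m _; congr (_ * _).
rewrite -(sum_eq_mem _ (fset_uniq A)); apply: eq_bigr => x _; congr (_ %:R).
by congr nat_of_bool; rewrite [RHS]eq_sym; apply/eqP/eqP => [<-|->];
  rewrite ?divfK ?mulfK // A0.
Qed.

Lemma sum_differences (U V : {fset R}) (K : seq R) (F : R -> R) :
  uniq K -> (forall u v, u \in U -> v \in V -> u - v \in K) ->
  \sum_(u <- U) \sum_(v <- V) F (u - v) = \sum_(f <- K) dif_reps U V f * F f.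
Proof.
move=> uK UVK; under [RHS]eq_bigr do rewrite mulr_suml.
rewrite [RHS]exchange_big /= big_seq [RHS]big_seq.
apply: eq_bigr => u uU.
rewrite (sum_fiber (t := K) (h := fun v => u - v)) // => [|v vV]; last exact: UVK.
apply: eq_bigr => f _; congr (_ * _).
rewrite -(sum_eq_mem _ (fset_uniq V)); apply: eq_bigr => v _; congr (_ %:R).
by congr nat_of_bool; apply/eqP/eqP => [<-|<-]; rewrite ?subKr.
Qed.

Lemma sum_products (A : {fset R}) (K : seq R) (F : R -> R) :
  (forall x, x \in A -> x != 0) -> uniq K ->
  (forall x y, x \in A -> y \in A -> x * y \in K) ->
  \sum_(x <- A) \sum_(y <- A) F (x * y) = \sum_(t <- K) prod_reps A t * F t.
Proof.
move=> A0 uK AK; under [RHS]eq_bigr do rewrite mulr_suml.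
rewrite [RHS]exchange_big /= big_seq [RHS]big_seq.
apply: eq_bigr => x xA.
rewrite (sum_fiber (t := K) (h := fun y => x * y)) // => [|y yA]; last exact: AK.
apply: eq_bigr => m _; congr (_ * _).
rewrite -(sum_eq_mem _ (fset_uniq A)); apply: eq_bigr => y _; congr (_ %:R).
by congr nat_of_bool; apply/eqP/eqP => [<-|<-]; rewrite mulrC ?mulKf ?divfK // A0.
Qed.

(** Cauchy-Schwarz over the fibres of [h]. It will be used for A(A + a) and for the intersection of
    A(A + a) with a translate. *)
Lemma size_sq_le_collisions (I J : eqType) (s : seq I) (t : seq J) (h : I -> J) :
  uniq t -> (forall i, i \in s -> h i \in t) ->
  (size s)%:R ^+ 2 <=
    (size t)%:R * \sum_(p <- s) \sum_(q <- s) (h p == h q)%:R :> R.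
Proof.
move=> ut ht.
have -> : \sum_(p <- s) \sum_(q <- s) (h p == h q)%:R =
   \sum_(k <- t) (\sum_(p <- s) (h p == k)%:R) ^+ 2 :> R.
  under [RHS]eq_bigr do rewrite expr2.
  rewrite -(sum_fiber (fun k => \sum_(p <- s) (h p == k)%:R) ut ht).
  by apply: eq_bigr => p _; apply: eq_bigr => q _; rewrite eq_sym.
apply: le_trans (sum_sq_le _ _).
have -> : \sum_(k <- t) \sum_(p <- s) (h p == k)%:R = (size s)%:R :> R; last by [].
transitivity (\sum_(k <- t) (\sum_(p <- s) (h p == k)%:R) * 1 : R).
  by apply: eq_bigr => k _; rewrite mulr1.
rewrite -(sum_fiber (fun=> 1) ut ht).
by rewrite big_const_seq count_predT iter_addr addr0.
Qed.

Lemma shift_quot_repsE (A : {fset R}) (x x' : R) : x' != 0 ->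
  shift_quot_reps A (x / x') =
  \sum_(a <- A) \sum_(y <- A) \sum_(y' <- A) (x * (y + a) == x' * (y' + a))%:R.
Proof.
move=> x0; apply: eq_bigr => a _; apply: eq_bigr => y _.
rewrite -(sum_eq_mem _ (fset_uniq A)); apply: eq_bigr => y' _.
congr (_ %:R); congr nat_of_bool; apply/eqP/eqP => [<-|e].
  by rewrite subrK; field.
by rewrite mulrAC e mulrAC divff // mul1r addrK.
Qed.

(** Both sides are the multiplicative energy. Collisions in A(A + a) produce it through quotients,
    while the popular set [B] has to be a set of products. *)
Lemma quot_energyE (A : {fset R}) (M K : seq R) :
  (forall x, x \in A -> x != 0) -> uniq M -> uniq K ->
  (forall x y, x \in A -> y \in A -> x / y \in M) ->
  (forall x y, x \in A -> y \in A -> x * y \in K) ->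
  \sum_(m <- M) quot_reps A m ^+ 2 = \sum_(t <- K) prod_reps A t ^+ 2.
Proof.
move=> A0 uM uK AM AK.
under eq_bigr do rewrite expr2.
rewrite -(sum_quotients (quot_reps A) A0 uM AM).
under [RHS]eq_bigr do rewrite expr2.
rewrite -(sum_products (prod_reps A) A0 uK AK).
apply: eq_bigr => x _; rewrite exchange_big /=; apply: eq_bigr => z _.
by apply: eq_bigr => y _; rewrite mulrAC.
Qed.

Lemma pigeonhole_sum (I : eqType) (s : seq I) (F : I -> R) : s != [::] ->
  exists2 i, i \in s & \sum_(j <- s) F j <= (size s)%:R * F i.
Proof.
elim: s => // x s IH _; have [->|sn0] := eqVneq s [::].
  by exists x; rewrite ?mem_head // big_seq1 mul1r.
have [i is_ Fi] := IH sn0; rewrite big_cons.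
have [le|/ltW le] := lerP (F i) (F x).
  exists x; rewrite ?mem_head //= -natr1 mulrDl mul1r addrC lerD2r.
  by apply: le_trans Fi _; rewrite ler_wpM2l.
by exists i; rewrite ?in_cons ?is_ ?orbT //= -natr1 mulrDl mul1r addrC lerD.
Qed.

Lemma prod_reps_nat (A : {fset R}) t :
  prod_reps A t = (count (fun x => t / x \in A) A)%:R.
Proof.
rewrite /prod_reps -sum1_count natr_sum [RHS]big_mkcond.
by apply: eq_bigr => x _ /=; case: ifP.
Qed.

(** Pigeonhole over the levels b <= r < 2b with b = 2^j: the number of levels is the only loss, and
    on the heaviest one r^2 <= 2 b r. *)
Lemma dyadic_product_set (A : {fset R}) (K : seq R) :
  uniq K -> (0 < #|` A|%fset)%N ->
  exists (B : {fset R}) (b : R),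
   [/\ 1 <= b, b <= (#|` A|%fset)%:R,
       forall t, t \in B -> t \in K /\ b <= prod_reps A t
     & \sum_(t <- K) prod_reps A t ^+ 2 <=
        (trunc_log 2 #|` A|%fset).+1%:R * (2 * b * \sum_(t <- B) prod_reps A t)].
Proof.
move=> uK A0.
pose c t := count (fun x => t / x \in A) A.
pose lev t := trunc_log 2 (c t).
pose J := (trunc_log 2 #|` A|%fset).+1.
(* [trunc_log] sends 0 to 0, so elements without representations would land in level 0 and violate r
   >= 1. *)
pose K' := [seq t <- K | (0 < c t)%N].
have -> : \sum_(t <- K) prod_reps A t ^+ 2 = \sum_(t <- K') prod_reps A t ^+ 2.
  rewrite big_filter [RHS]big_mkcond; apply: eq_bigr => t _.
  by rewrite prod_reps_nat -/(c t); case: (c t) => //=; rewrite expr0n.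
have cle t : (c t <= #|` A|%fset)%N by apply: count_size.
have levJ t : t \in K' -> lev t \in iota 0 J.
  by move=> _; rewrite mem_iota /= add0n ltnS leq_trunc_log.
have -> : \sum_(t <- K') prod_reps A t ^+ 2 =
   \sum_(j <- iota 0 J) \sum_(t <- K' | lev t == j) prod_reps A t ^+ 2.
  under [RHS]eq_bigr do rewrite big_mkcond.
  rewrite exchange_big /= big_seq [RHS]big_seq; apply: eq_bigr => t tK.
  transitivity (\sum_(j <- iota 0 J) (lev t == j)%:R * prod_reps A t ^+ 2).
    by rewrite (sum_indic _ (fun=> _)) ?iota_uniq // levJ // mul1r.
  by apply: eq_bigr => j _; case: eqP; rewrite ?mul1r ?mul0r.
have [|j jJ Hj] := @pigeonhole_sum _ (iota 0 J)
  (fun j => \sum_(t <- K' | lev t == j) prod_reps A t ^+ 2); first by [].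
pose B := [fset t in [seq t <- K' | lev t == j]]%fset.
have BK t : t \in B -> [/\ t \in K, (0 < c t)%N & lev t = j].
  by rewrite in_fset /= !mem_filter => /and3P[/eqP ? ? ?].
exists B, (2 ^+ j); split.
- by rewrite exprn_ege1 // ler1n.
- rewrite -natrX ler_nat; apply: leq_trans (trunc_logP (isT : (1 < 2)%N) A0).
  by rewrite leq_exp2l //; move: jJ; rewrite mem_iota.
- move=> t /BK[tK ct levt]; split=> //.
  by rewrite prod_reps_nat -natrX ler_nat -levt; apply: trunc_logP.
apply: le_trans Hj _; rewrite size_iota ler_wpM2l // mulr_sumr.
rewrite -big_filter.
have -> : \sum_(t <- B) 2 * 2 ^+ j * prod_reps A t =
   \sum_(t <- [seq t <- K' | lev t == j]) 2 * 2 ^+ j * prod_reps A t.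
  by apply: perm_big; apply: uniq_perm; rewrite ?fset_uniq ?filter_uniq // => t; rewrite in_fset.
apply: ler_sum_seq => t; rewrite !mem_filter => /and3P[/eqP levt ct tK] _.
rewrite expr2 ler_wpM2r //; first by rewrite prod_reps_nat ler0n.
rewrite prod_reps_nat -natrX -natrM ler_nat -expnS -levt ltnW //.
exact: trunc_log_ltn.
Qed.
End Quotients.

(** * Comparison of exponents *)

Section Exponents.
Variable R : realFieldType.

Lemma exprn_le_compare (x y : R) (j k p q : nat) : 1 <= x -> 0 <= y -> (0 < k)%N ->
  (p * k <= j * q)%N -> x ^+ j <= y ^+ k -> x ^+ p <= y ^+ q.
Proof.
move=> x1 y0 k0 pkjq xy; have x0 : 0 <= x by apply: le_trans x1.
rewrite -(@ler_pXn2r _ k) ?nnegrE ?exprn_ge0 //.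
rewrite -!exprM; apply: le_trans (ler_weXn2l x1 pkjq) _.
by rewrite exprM [(q * k)%N]mulnC [y ^+ _]exprM lerXn2r ?nnegrE ?exprn_ge0.
Qed.

Section Arithmetic.
(** [Z] is a sum over a of additive correlations of [B] with A(A + a), [V] bounds the collisions
    among Katz-Koester translates, [X] is the third moment of differences of A', and [Y] bounds the
    one for [B]. [c] absorbs all numerical constants. *)
Variables n s h b t c Z V X Y : R.
Hypotheses (n1 : 1 <= n) (s1 : 1 <= s) (h1 : 1 <= h) (b1 : 1 <= b) (bn : b <= n).
Hypotheses (t0 : 0 < t) (c4 : 4 <= c).
Hypotheses (Z0 : 0 <= Z) (V0 : 0 <= V) (X0 : 0 <= X) (Y0 : 0 <= Y).
Hypothesis energy : n ^+ 6 <= c * h ^+ 3 * s ^+ 2 * (b * t).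
Hypothesis moments : (n * t ^+ 2 / (c * s)) ^+ 3
  * (t ^+ 4 / (c * n ^+ 4 * h ^+ 2 * s ^+ 2)) ^+ 2 <= Z * V * (n * (X + Y)).
Hypothesis Z_le : (b ^+ 2 * Z) ^+ 2 <= c * h ^+ 2 * n ^+ 8 * s ^+ 3.
Hypothesis V_le : V ^+ 2 <= c * h ^+ 2 * n ^+ 5 * X.
Hypothesis X_le : t * b ^+ 2 * X <= c * h ^+ 2 * n ^+ 7.
Hypothesis Y_le : b ^+ 5 * Y <= c * h ^+ 2 * n ^+ 4 * t ^+ 2.

Let n0 : 0 < n. Proof. exact: lt_le_trans n1. Qed.
Let s0 : 0 < s. Proof. exact: lt_le_trans s1. Qed.
Let h0 : 0 < h. Proof. exact: lt_le_trans h1. Qed.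
Let b0 : 0 < b. Proof. exact: lt_le_trans b1. Qed.
Let c0 : 0 < c. Proof. exact: lt_le_trans c4. Qed.
Let n_ge0 : 0 <= n. Proof. exact: ltW. Qed.
Let s_ge0 : 0 <= s. Proof. exact: ltW. Qed.
Let h_ge0 : 0 <= h. Proof. exact: ltW. Qed.
Let b_ge0 : 0 <= b. Proof. exact: ltW. Qed.
Let t_ge0 : 0 <= t. Proof. exact: ltW. Qed.
Let c_ge0 : 0 <= c. Proof. exact: ltW. Qed.
Let c1 : 1 <= c. Proof. by apply: le_trans c4; lra. Qed.

(** [Z] and [V] are bounded only through their squares, so [moments] is squared. The factor 4 from
    (2m)^2 is absorbed by [c4]. *)
Let moments_sq m : X + Y <= 2 * m ->
  t ^+ 29 * b ^+ 6 <= c ^+ 14 * h ^+ 14 * n ^+ 32 * s ^+ 17 * m ^+ 2.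
Proof.
move=> XYm.
have m0 : 0 <= m.
  have : 0 <= 2 * m by apply: le_trans XYm; rewrite addr_ge0.
  by rewrite pmulr_rge0.
have lhs0 : 0 <= (n * t ^+ 2 / (c * s)) ^+ 3
  * (t ^+ 4 / (c * n ^+ 4 * h ^+ 2 * s ^+ 2)) ^+ 2.
  by rewrite mulr_ge0 // exprn_ge0 // divr_ge0 ?mulr_ge0 ?exprn_ge0 //.
have rhs0 : 0 <= Z * V * (n * (X + Y)) by rewrite !mulr_ge0 ?addr_ge0 ?(ltW n0).
have sq := lerXn2r 2 lhs0 rhs0 moments.
have h1' : (b ^+ 2 * Z) ^+ 2 * V ^+ 2 * (t * b ^+ 2) <=
   (c * h ^+ 2 * n ^+ 8 * s ^+ 3) * (c * h ^+ 2 * n ^+ 5 * (c * h ^+ 2 * n ^+ 7)).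
  rewrite -[leLHS]mulrA; apply: ler_pM => //; first by rewrite sqr_ge0.
    by rewrite !mulr_ge0 ?sqr_ge0 ?exprn_ge0.
  apply: le_trans (_ : c * h ^+ 2 * n ^+ 5 * X * (t * b ^+ 2) <= _).
    by rewrite ler_wpM2r // mulr_ge0 ?exprn_ge0 //.
  have -> : c * h ^+ 2 * n ^+ 5 * X * (t * b ^+ 2) =
     c * h ^+ 2 * n ^+ 5 * (t * b ^+ 2 * X) by ring.
  by rewrite ler_wpM2l // !mulr_ge0 ?exprn_ge0 //.
have h2' : (n * (X + Y)) ^+ 2 <= (n * (2 * m)) ^+ 2.
  by rewrite lerXn2r ?nnegrE ?mulr_ge0 ?addr_ge0 ?(ltW n0) // ler_wpM2l //.
(* [k] clears the denominators of the squared left side, which is t^28 / k. The extra t b^6 is what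
   the bounds on Z^2 (b^4) and on [X] (t b^2) consume. *)
pose k := c ^+ 10 * n ^+ 10 * s ^+ 14 * h ^+ 8.
have k0 : 0 < k by rewrite !mulr_gt0 ?exprn_gt0.
have -> : t ^+ 29 * b ^+ 6 = k * (((n * t ^+ 2 / (c * s)) ^+ 3
  * (t ^+ 4 / (c * n ^+ 4 * h ^+ 2 * s ^+ 2)) ^+ 2) ^+ 2) * (t * b ^+ 6).
  by rewrite /k; field; rewrite !gt_eqF.
apply: le_trans (_ : k * (Z * V * (n * (X + Y))) ^+ 2 * (t * b ^+ 6) <= _).
  rewrite ler_wpM2r ?mulr_ge0 ?exprn_ge0 ?(ltW t0) ?(ltW b0) //.
  by rewrite ler_wpM2l ?(ltW k0).
have -> : k * (Z * V * (n * (X + Y))) ^+ 2 * (t * b ^+ 6) =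
  k * (((b ^+ 2 * Z) ^+ 2 * V ^+ 2 * (t * b ^+ 2)) * (n * (X + Y)) ^+ 2) by ring.
apply: le_trans (_ : k * ((c * h ^+ 2 * n ^+ 8 * s ^+ 3)
  * (c * h ^+ 2 * n ^+ 5 * (c * h ^+ 2 * n ^+ 7)) * (n * (2 * m)) ^+ 2) <= _).
  rewrite ler_wpM2l ?(ltW k0) // ler_pM ?sqr_ge0 //.
  by rewrite !mulr_ge0 ?sqr_ge0 ?exprn_ge0 //.
have -> : k * ((c * h ^+ 2 * n ^+ 8 * s ^+ 3)
  * (c * h ^+ 2 * n ^+ 5 * (c * h ^+ 2 * n ^+ 7)) * (n * (2 * m)) ^+ 2) =
  4 * (c ^+ 13 * h ^+ 14 * n ^+ 32 * s ^+ 17 * m ^+ 2) by rewrite /k; ring.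
have -> : c ^+ 14 * h ^+ 14 * n ^+ 32 * s ^+ 17 * m ^+ 2 =
  c * (c ^+ 13 * h ^+ 14 * n ^+ 32 * s ^+ 17 * m ^+ 2) by ring.
by rewrite ler_wpM2r // !mulr_ge0 ?sqr_ge0 ?exprn_ge0 //.
Qed.

Let final_compare (i j k p q : nat) : (i <= k)%N -> (j <= 2 * k)%N -> (0 < k)%N ->
  (140 * k <= p * 93)%N ->
  n ^+ p <= c ^+ i * h ^+ j * s ^+ k ->
  n ^+ 140 <= (c * h ^+ 2 * s) ^+ 93.
Proof.
move=> ik jk k0 pk le.
have u0 : 0 <= c * h ^+ 2 * s by rewrite !mulr_ge0 ?exprn_ge0 //.
apply: (exprn_le_compare n1 u0 k0 pk); apply: le_trans le _.
rewrite [(c * h ^+ 2 * s) ^+ k]exprMn [(c * h ^+ 2) ^+ k]exprMn -exprM.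
by rewrite !ler_pM ?mulr_ge0 ?exprn_ge0 ?(ltW c0) ?(ltW h0) ?(ltW s0) // ler_weXn2l.
Qed.

Let energy_pow k : n ^+ (6 * k) <= c ^+ k * h ^+ (3 * k) * s ^+ (2 * k) * (b * t) ^+ k.
Proof.
rewrite exprM [h ^+ _]exprM [s ^+ _]exprM -!exprMn.
by rewrite lerXn2r ?nnegrE ?exprn_ge0 // !mulr_ge0 ?exprn_ge0 //.
Qed.

(* According to which of X and Y dominates, s >> n^(119/79) or s >> n^(101/67) up
   to powers of h; both exponents exceed 140/93 = 3/2 + 1/186. *)
Lemma growth_arithmetic : n ^+ 140 <= (c * h ^+ 2 * s) ^+ 93.
Proof.
pose al := c * h ^+ 2 * n ^+ 7 / (t * b ^+ 2).
pose ga := c * h ^+ 2 * n ^+ 4 * t ^+ 2 / b ^+ 5.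
have Xal : X <= al by rewrite ler_pdivlMr ?mulr_gt0 ?exprn_gt0 // mulrC.
have Yga : Y <= ga by rewrite ler_pdivlMr ?exprn_gt0 // mulrC.
have [le|/ltW le] := lerP ga al.
  have XY : X + Y <= 2 * al by lra.
  have := moments_sq XY.
  have -> : c ^+ 14 * h ^+ 14 * n ^+ 32 * s ^+ 17 * al ^+ 2 =
    c ^+ 16 * h ^+ 18 * n ^+ 46 * s ^+ 17 / (t ^+ 2 * b ^+ 4).
    by rewrite /al; field; rewrite !gt_eqF.
  rewrite ler_pdivlMr ?mulr_gt0 ?exprn_gt0 // => main.
  apply: (@final_compare 47 111 79 119 0) => //.
  (* The power 31 of the energy bound matches t^(29 + 2) in [main]. The surplus b^21 is at most
     n^21, so n^(46 + 21) on the right is cancelled from n^186. *)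
  rewrite -(@ler_pM2r _ (n ^+ 67)) ?exprn_gt0 // -exprD.
  apply: le_trans (energy_pow 31) _.
  have -> : c ^+ 31 * h ^+ (3 * 31) * s ^+ (2 * 31) * (b * t) ^+ 31 =
    c ^+ 31 * h ^+ 93 * s ^+ 62 * ((t ^+ 29 * b ^+ 6 * (t ^+ 2 * b ^+ 4)) * b ^+ 21) by ring.
  have -> : c ^+ 47 * h ^+ 111 * s ^+ 79 * n ^+ 67 =
    c ^+ 31 * h ^+ 93 * s ^+ 62 * (c ^+ 16 * h ^+ 18 * n ^+ 46 * s ^+ 17 * n ^+ 21) by ring.
  rewrite ler_wpM2l ?mulr_ge0 ?exprn_ge0 ?(ltW c0) ?(ltW h0) ?(ltW s0) //.
  apply: ler_pM => //; rewrite ?mulr_ge0 ?exprn_ge0 ?(ltW t0) ?(ltW b0) //.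
  by rewrite lerXn2r ?nnegrE //.
have XY : X + Y <= 2 * ga by lra.
have := moments_sq XY.
have -> : c ^+ 14 * h ^+ 14 * n ^+ 32 * s ^+ 17 * ga ^+ 2 =
  (c ^+ 16 * h ^+ 18 * n ^+ 40 * s ^+ 17 * t ^+ 4) / b ^+ 10.
  by rewrite /ga; field; rewrite !gt_eqF.
rewrite ler_pdivlMr ?exprn_gt0 // => main.
have {}main : t ^+ 25 * b ^+ 16 <= c ^+ 16 * h ^+ 18 * n ^+ 40 * s ^+ 17.
  rewrite -(@ler_pM2r _ (t ^+ 4)) ?exprn_gt0 //; apply: le_trans main.
  by rewrite le_eqVlt; apply/orP; left; apply/eqP; ring.
apply: (@final_compare 41 93 67 101 0) => //.
(* Likewise with the power 25: the surplus is b^9 <= n^9, and n^(40 + 9) is cancelled from n^150. *)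
rewrite -(@ler_pM2r _ (n ^+ 49)) ?exprn_gt0 // -exprD.
apply: le_trans (energy_pow 25) _.
have -> : c ^+ 25 * h ^+ (3 * 25) * s ^+ (2 * 25) * (b * t) ^+ 25 =
  c ^+ 25 * h ^+ 75 * s ^+ 50 * ((t ^+ 25 * b ^+ 16) * b ^+ 9) by ring.
have -> : c ^+ 41 * h ^+ 93 * s ^+ 67 * n ^+ 49 =
  c ^+ 25 * h ^+ 75 * s ^+ 50 * (c ^+ 16 * h ^+ 18 * n ^+ 40 * s ^+ 17 * n ^+ 9) by ring.
rewrite ler_wpM2l ?mulr_ge0 ?exprn_ge0 ?(ltW c0) ?(ltW h0) ?(ltW s0) //.
apply: ler_pM => //; rewrite ?mulr_ge0 ?exprn_ge0 ?(ltW t0) ?(ltW b0) //.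
by rewrite lerXn2r ?nnegrE //.
Qed.
End Arithmetic.
End Exponents.

(** * The growth of A(A + a) *)

Section KatzKoester.
Variable R : realFieldType.

(** The equation u - u' = v - v' of the additive energy is rearranged to u - v = u' - v', so that
    mixed differences of [U] and [V] can be used. *)
Lemma sum_dif_reps_mul_le (U V : {fset R}) (F K : seq R) :
  uniq F -> uniq K -> (forall u v, u \in U -> v \in V -> u - v \in K) ->
  \sum_(f <- F) dif_reps U U f * dif_reps V V f <= \sum_(k <- K) dif_reps U V k ^+ 2.
Proof.
move=> uF uK UVK.
under [leRHS]eq_bigr do rewrite expr2.
rewrite -(sum_differences (dif_reps U V) uK UVK).
under eq_bigr do rewrite big_distrlr /=.
rewrite exchange_big /=; apply: ler_sum => u _.
rewrite exchange_big /=; apply: ler_sum => v _.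
have -> : \sum_(f <- F) (u - f \in U)%:R * (v - f \in V)%:R =
  \sum_(f <- F | u - f \in U) (v - f \in V)%:R :> R.
  by rewrite [RHS]big_mkcond; apply: eq_bigr => f _; case: ifP; rewrite ?mul1r ?mul0r.
apply: (@ler_sum_inj _ _ _ _ _ _ (fun f => u - f)) => //.
- by move=> f f' _ _ _ _ /addrI/oppr_inj.
- move=> f _ _; have -> // : u - f - (u - v) = v - f by ring.
Qed.

Section Growth.
Variables (A : {fset R}) (s h : R).
Local Notation n := ((#|` A|%fset)%:R : R).
Hypothesis A_gt0 : forall x, x \in A -> 0 < x.
Hypothesis A_neq0 : (0 < #|` A|%fset)%N.

Definition shifted_products (a : R) : {fset R} :=
  [fset x * (y + a) | x in A, y in A]%fset.

Hypothesis growth_le : forall a, a \in A -> (#|` shifted_products a|%fset)%:R <= s.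
(** The argument 2n^2 covers every side of a grid used below: A with its reflection has at most 2n
    elements, while [B] and A(A + a) have at most n^2. *)
Hypothesis harmonic_le : harmonic_sum R (2 * #|` A|%fset ^ 2) <= h.
Hypothesis log_le : (trunc_log 2 #|` A|%fset).+1%:R <= h.

Let n_ge1 : 1 <= n. Proof. by rewrite ler1n. Qed.
Let n_gt0 : 0 < n. Proof. by rewrite ltr0n. Qed.
Let n_ge0 : 0 <= n. Proof. by rewrite ler0n. Qed.
Let h_ge1 : 1 <= h. Proof. by apply: le_trans log_le; rewrite ler1n. Qed.
Let A_unit x : x \in A -> x != 0. Proof. by move=> /A_gt0 /gt_eqF ->. Qed.

Let harmonic_le_h k : k%:R <= n ^+ 2 -> harmonic_sum R k <= h.
Proof.
rewrite -natrX ler_nat => kn; apply: le_trans harmonic_le.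
by apply: harmonic_sum_le; lia.
Qed.

Lemma mem_shifted_products a x y :
  x \in A -> y \in A -> x * (y + a) \in shifted_products a.
Proof. by move=> xA yA; apply/imfset2P; exists x => //; exists y. Qed.

Lemma card_shifted_products_le a : (#|` shifted_products a|%fset)%:R <= n ^+ 2.
Proof.
pose L := [seq x * (y + a) | x <- enum_fset A, y <- enum_fset A].
have -> : n ^+ 2 = (size L)%:R by rewrite size_allpairs natrM expr2.
rewrite ler_nat; apply: uniq_leq_size; first exact: fset_uniq.
by move=> z /imfset2P[x xA [y yA ->]]; apply/allpairsP; exists (x, y).
Qed.

Lemma growth_ge1 : 1 <= s.
Proof.
case: (fset_0Vmem A) A_neq0 => [->|[a aA] _]; first by rewrite cardfs0.
apply: le_trans (growth_le aA); rewrite ler1n cardfs_gt0.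
by apply/fset0Pn; exists (a * (a + a)); apply: mem_shifted_products.
Qed.

(** Applied to all pairs this leads to the energy bound, applied to pairs with product in [B] to the
    popular solutions. *)
Lemma shifted_collisions (T : seq (R * R)) :
  (forall p, p \in T -> p.1 \in A /\ p.2 \in A) ->
  n * (size T)%:R ^+ 2 <= s * \sum_(a <- A) \sum_(p <- T) \sum_(q <- T)
     (p.1 * (p.2 + a) == q.1 * (q.2 + a))%:R.
Proof.
move=> TA; rewrite mulr_sumr.
have -> : n * (size T)%:R ^+ 2 = \sum_(a <- A) (size T)%:R ^+ 2.
  by rewrite big_const_seq count_predT iter_addr addr0 mulr_natl.
apply: ler_sum_seq => a aA _.
apply: le_trans (@size_sq_le_collisions _ _ _ _ (shifted_products a)
  (fun p => p.1 * (p.2 + a)) (fset_uniq _) _) _.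
  by move=> p /TA[]; apply: mem_shifted_products.
rewrite ler_wpM2r ?growth_le // sumr_ge0 // => p _.
by apply: sumr_ge0 => q _; rewrite ler0n.
Qed.

Let M := [fset x / y | x in A, y in A]%fset.
Let K := [fset x * y | x in A, y in A]%fset.

Let mem_M x y : x \in A -> y \in A -> x / y \in M.
Proof. by move=> xA yA; apply/imfset2P; exists x => //; exists y. Qed.

Let mem_K x y : x \in A -> y \in A -> x * y \in K.
Proof. by move=> xA yA; apply/imfset2P; exists x => //; exists y. Qed.

Let c1 : R := 128.

Let shift_quot_sum_sq : \sum_(m <- M) shift_quot_reps A m ^+ 2 <= c1 * n ^+ 4 * h ^+ 2.
Proof.
apply: le_trans (shift_quot_second_moment A_gt0 (fset_uniq M)) _.
rewrite ler_wpM2l ?mulr_ge0 ?exprn_ge0 //.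
rewrite lerXn2r ?nnegrE ?harmonic_sum_ge0 //; first exact: le_trans h_ge1.
apply: le_trans harmonic_le; apply: harmonic_sum_le.
by rewrite leq_mul2l /= expnS expn1 leq_pmulr.
Qed.

Let E := \sum_(m <- M) quot_reps A m ^+ 2.

Lemma energy_lower_bound : n ^+ 6 <= c1 * h ^+ 2 * s ^+ 2 * E.
Proof.
pose P := [seq (x, y) | x <- enum_fset A, y <- enum_fset A].
have PA p : p \in P -> p.1 \in A /\ p.2 \in A.
  by case/allpairsP => [[a y]] /= [aA yA ->].
have := shifted_collisions PA.
have -> : (size P)%:R = n ^+ 2 by rewrite size_allpairs natrM expr2.
have -> : \sum_(a <- A) \sum_(p <- P) \sum_(q <- P)
     (p.1 * (p.2 + a) == q.1 * (q.2 + a))%:R =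
     \sum_(m <- M) quot_reps A m * shift_quot_reps A m.
  rewrite -(sum_quotients (shift_quot_reps A) A_unit (fset_uniq M) mem_M).
  transitivity (\sum_(a <- A) \sum_(x <- A) \sum_(y <- A) \sum_(x' <- A) \sum_(y' <- A)
     (x * (y + a) == x' * (y' + a))%:R : R).
    apply: eq_bigr => a _; rewrite big_allpairs; apply: eq_bigr => x _.
    by apply: eq_bigr => y _; rewrite big_allpairs.
  rewrite exchange_big /=; apply: eq_bigr => x _.
  under eq_bigr do rewrite exchange_big /=.
  rewrite exchange_big /= big_seq [RHS]big_seq; apply: eq_bigr => x' x'A.
  by rewrite shift_quot_repsE // A_unit.
rewrite -exprM -exprS => n5.
have CS := sum_CauchySchwarz M (quot_reps A) (shift_quot_reps A).
set X := \sum_(m <- M) _ * _ in n5 CS.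
have E0 : 0 <= E by apply: sumr_ge0 => m _; rewrite exprn_ge0 // quot_reps_ge0.
have s0 : 0 <= s by apply: le_trans growth_ge1.
have X0 : 0 <= X.
  by apply: sumr_ge0 => m _; rewrite mulr_ge0 ?quot_reps_ge0 ?shift_quot_reps_ge0.
have h10 : (n ^+ 5) ^+ 2 <= s ^+ 2 * (E * (c1 * n ^+ 4 * h ^+ 2)).
  apply: le_trans (_ : (s * X) ^+ 2 <= _).
    by rewrite lerXn2r ?nnegrE ?exprn_ge0 // mulr_ge0.
  rewrite exprMn ler_wpM2l ?exprn_ge0 //.
  by apply: le_trans CS _; rewrite ler_wpM2l.
rewrite -(@ler_pM2l _ (n ^+ 4)) ?exprn_gt0 //.
apply: le_trans (le_trans _ h10) _; first by rewrite -exprM -exprD.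
by rewrite le_eqVlt; apply/orP; left; apply/eqP; ring.
Qed.

(** * Popular products, popular quotients and their moments *)

Section Popular.
Variables (B : {fset R}) (b D : R).
Hypothesis b_ge1 : 1 <= b.
Hypothesis B_reps : forall u, u \in B -> u \in K /\ b <= prod_reps A u.
Hypothesis D_gt0 : 0 < D.

Let t := \sum_(u <- B) prod_reps A u.
Hypothesis t_gt0 : 0 < t.

Let deg x : R := \sum_(y <- A) (x * y \in B)%:R.
(** The average of [deg] over A is t / n. Discarding x below half of it loses at most half of the
    pairs, and leaves elements that each lie in many dilates of [B]. *)
Let A' := [fset x in A | t / (2 * n) <= deg x]%fset.
Let good m := D <= quot_reps A m.

Let A'A x : x \in A' -> x \in A /\ t / (2 * n) <= deg x.
Proof. by rewrite !inE => /andP[]. Qed.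

Let b_gt0 : 0 < b. Proof. exact: lt_le_trans b_ge1. Qed.
Let h_ge0 : 0 <= h. Proof. exact: le_trans h_ge1. Qed.
Let s_ge1 : 1 <= s. Proof. exact: growth_ge1. Qed.
Let s_ge0 : 0 <= s. Proof. exact: le_trans s_ge1. Qed.

Let sum_deg : \sum_(x <- A) deg x = t.
Proof.
rewrite /t [RHS]exchange_big /= big_seq [RHS]big_seq; apply: eq_bigr => x xA.
transitivity (\sum_(y <- A) \sum_(u <- B) (x * y == u)%:R : R).
  by apply: eq_bigr => y _; rewrite sum_eq_mem.
rewrite exchange_big /=; apply: eq_bigr => u _.
rewrite -(sum_eq_mem R _ (fset_uniq A)); apply: eq_bigr => y _.
by congr (_ %:R); congr nat_of_bool; apply/eqP/eqP => [<-|<-];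
  rewrite mulrC ?mulKf ?divfK // A_unit.
Qed.

Let card_K_le : (#|` K|%fset)%:R <= n ^+ 2.
Proof.
pose L := [seq x * y | x <- enum_fset A, y <- enum_fset A].
have -> : n ^+ 2 = (size L)%:R by rewrite size_allpairs natrM expr2.
rewrite ler_nat; apply: uniq_leq_size; first exact: fset_uniq.
by move=> z /imfset2P[x xA [y yA ->]]; apply/allpairsP; exists (x, y).
Qed.

Let card_B_le : (#|` B|%fset)%:R <= n ^+ 2.
Proof.
apply: le_trans card_K_le; rewrite ler_nat; apply: uniq_leq_size; first exact: fset_uniq.
by move=> u /B_reps[].
Qed.

Let card_B_b : (#|` B|%fset)%:R * b <= t.
Proof.
have -> : (#|` B|%fset)%:R * b = \sum_(u <- B) b.
  by rewrite big_const_seq count_predT iter_addr addr0 mulr_natl.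
by apply: ler_sum_seq => u /B_reps[].
Qed.

Let card_A'_le : (#|` A'|%fset)%:R <= n.
Proof.
rewrite ler_nat; apply: uniq_leq_size; first exact: fset_uniq.
by move=> u /A'A[].
Qed.

Let n_le_sq : n <= n ^+ 2. Proof. by rewrite expr2 ler_peMl. Qed.

Let moment_bound (d v w k l : R) : 0 <= d -> 0 <= v -> 0 <= w -> 0 <= k <= h -> 0 <= l <= h ->
  w * d * v <= d ^+ 2 * v ^+ 2 ->
  8 * (d ^+ 2 * v ^+ 2 * (k * l)) + w * d * v <= 9 * h ^+ 2 * (d ^+ 2 * v ^+ 2).
Proof.
move=> d0 v0 w0 /andP[k0 kh] /andP[l0 lh] wdv.
have dv0 : 0 <= d ^+ 2 * v ^+ 2 by rewrite mulr_ge0 ?exprn_ge0.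
have kl : k * l <= h ^+ 2 by rewrite expr2 ler_pM.
have h1 : 1 <= h ^+ 2 by rewrite exprn_ege1.
have : d ^+ 2 * v ^+ 2 * (k * l) <= d ^+ 2 * v ^+ 2 * h ^+ 2 by rewrite ler_wpM2l.
have : d ^+ 2 * v ^+ 2 * 1 <= d ^+ 2 * v ^+ 2 * h ^+ 2 by rewrite ler_wpM2l.
lra.
Qed.

Let natr_le_sq k : k%:R <= k%:R ^+ 2 :> R.
Proof. by rewrite -natrX ler_nat; case: k => // k; rewrite expnS expn1 leq_pmulr. Qed.

(** Each x in A' lies in at least t / (2n) dilates w^(-1) B with w in A. The resulting |B|^2 is
    removed by |B| b <= t, and 72 is 9 * 2^3. *)
Lemma dif_reps_A'_third_moment (F : {fset R}) :
  t * b ^+ 2 * \sum_(f <- F) dif_reps A' A' f ^+ 3 <= 72 * h ^+ 2 * n ^+ 7.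
Proof.
have inv_gt0 w : w \in A -> 0 < w^-1 by move=> /A_gt0; rewrite invr_gt0.
have inv_inj : {in A &, injective (@GRing.inv R)} by move=> x y _ _; apply: invr_inj.
have d0 : 0 <= t / (2 * n) by rewrite divr_ge0 ?mulr_ge0 // ltW.
have rich u : u \in A' -> t / (2 * n) <= \sum_(w <- A) (u / w^-1 \in B)%:R.
  by move=> /A'A[_ /le_trans]; apply; apply: ler_sum => w _; rewrite invrK.
have := @dif_reps_third_moment R B A' A F (@GRing.inv R) inv_gt0 inv_inj A' _ d0 rich.
set S := \sum_(f <- F) _.
have S0 : 0 <= S by apply: sumr_ge0 => f _; rewrite exprn_ge0 // dif_reps_ge0.
set nB := (#|` B|%fset)%:R; set nA' := (#|` A'|%fset)%:R.
have A'2 : nA' ^+ 2 <= n ^+ 2 by rewrite lerXn2r ?nnegrE.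
have step : 8 * (nB ^+ 2 * nA' ^+ 2 * (harmonic_sum R #|` B|%fset * harmonic_sum R #|` A'|%fset))
   + n * nB * nA' <= 9 * h ^+ 2 * (nB ^+ 2 * n ^+ 2).
  apply: le_trans (_ : 8 * (nB ^+ 2 * n ^+ 2 * (harmonic_sum R #|` B|%fset * harmonic_sum R #|` A'|%fset))
   + n * nB * n <= _).
    rewrite lerD ?ler_wpM2l ?mulr_ge0 // ler_wpM2r ?mulr_ge0 ?harmonic_sum_ge0 //.
    by rewrite ler_wpM2l ?exprn_ge0.
  apply: moment_bound => //; rewrite ?harmonic_sum_ge0 ?harmonic_le_h //.
    exact: le_trans n_le_sq.
  have -> : n * nB * n = nB * n ^+ 2 by ring.
  by rewrite ler_wpM2r ?exprn_ge0 // natr_le_sq.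
move=> /le_trans /(_ (ler_wpM2l (exprn_ge0 2 n_ge0) step)) main.
have Bb : nB ^+ 2 * b ^+ 2 <= t ^+ 2.
  by rewrite -exprMn lerXn2r ?nnegrE ?mulr_ge0 // ltW.
have t2 : 0 < t ^+ 2 by rewrite exprn_gt0.
rewrite -(ler_pM2l t2).
have -> : t ^+ 2 * (t * b ^+ 2 * S) = 8 * n ^+ 3 * b ^+ 2 * ((t / (2 * n)) ^+ 3 * S).
  by field; rewrite gt_eqF.
apply: le_trans (_ : 8 * n ^+ 3 * b ^+ 2 * (n ^+ 2 * (9 * h ^+ 2 * (nB ^+ 2 * n ^+ 2))) <= _).
  by rewrite ler_wpM2l // !mulr_ge0 ?exprn_ge0 // ltW.
have -> : 8 * n ^+ 3 * b ^+ 2 * (n ^+ 2 * (9 * h ^+ 2 * (nB ^+ 2 * n ^+ 2))) =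
  (nB ^+ 2 * b ^+ 2) * (72 * h ^+ 2 * n ^+ 7) by ring.
by rewrite ler_wpM2r // !mulr_ge0 ?exprn_ge0.
Qed.

Let B_rich u : u \in B -> b <= \sum_(w <- A) (u / id w \in A)%:R.
Proof. by move=> /B_reps[]. Qed.

(** Here the dilates are wA: an element of [B] has at least [b] factorizations, so it lies in [b] of
    them. *)
Lemma dif_reps_B_third_moment (F : {fset R}) :
  b ^+ 5 * \sum_(f <- F) dif_reps B B f ^+ 3 <= 9 * h ^+ 2 * n ^+ 4 * t ^+ 2.
Proof.
have := @dif_reps_third_moment R A B A F id A_gt0 (in2W (fun _ _ e => e)) B b (ltW b_gt0) B_rich.
set S := \sum_(f <- F) _; set nB := (#|` B|%fset)%:R.
have step : 8 * (n ^+ 2 * nB ^+ 2 * (harmonic_sum R #|` A|%fset * harmonic_sum R #|` B|%fset))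
   + n * n * nB <= 9 * h ^+ 2 * (n ^+ 2 * nB ^+ 2).
  apply: moment_bound => //; rewrite ?harmonic_sum_ge0 ?harmonic_le_h //.
  by rewrite -expr2 ler_wpM2l ?exprn_ge0 // natr_le_sq.
move=> /le_trans /(_ (ler_wpM2l (exprn_ge0 2 n_ge0) step)) main.
have Bb : nB ^+ 2 * b ^+ 2 <= t ^+ 2.
  by rewrite -exprMn lerXn2r ?nnegrE ?mulr_ge0 // ltW.
have -> : b ^+ 5 * S = b ^+ 2 * (b ^+ 3 * S) by ring.
apply: le_trans (ler_wpM2l (exprn_ge0 2 (ltW b_gt0)) main) _.
have -> : b ^+ 2 * (n ^+ 2 * (9 * h ^+ 2 * (n ^+ 2 * nB ^+ 2))) =
  9 * h ^+ 2 * n ^+ 4 * (nB ^+ 2 * b ^+ 2) by ring.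
by rewrite ler_wpM2l // !mulr_ge0 ?exprn_ge0.
Qed.

(** The sum is at most the additive energy of [B] with A(A + a). Since [B] has many dilates meeting
    A, the second moment of the mixed differences is controlled by the grid A x A(A + a). *)
Lemma dif_reps_mul_bound (a : R) (F : seq R) : a \in A -> uniq F ->
  (b ^+ 2 * \sum_(f <- F) dif_reps B B f *
     dif_reps (shifted_products a) (shifted_products a) f) ^+ 2
  <= 9 * h ^+ 2 * n ^+ 6 * s ^+ 3.
Proof.
move=> aA uF; set S := shifted_products a.
pose L := [fset u - v | u in B, v in S]%fset.
have BSL u v : u \in B -> v \in S -> u - v \in L.
  by move=> uB vS; apply/imfset2P; exists u => //; exists v.
have := sum_dif_reps_mul_le uF (fset_uniq L) BSL.
set X := \sum_(f <- F) _; set Y := \sum_(k <- L) _ => XY.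
have X0 : 0 <= X by apply: sumr_ge0 => f _; rewrite mulr_ge0 // dif_reps_ge0.
have Y0 : 0 <= Y by apply: sumr_ge0 => f _; rewrite exprn_ge0 // dif_reps_ge0.
have := @dif_reps_second_moment R A S A L id A_gt0 (in2W (fun _ _ e => e)) B b (ltW b_gt0) B_rich.
rewrite -/Y; set nS := (#|` S|%fset)%:R.
have nSs : nS <= s by apply: growth_le.
have step : 8 * (n ^+ 2 * nS ^+ 2 * (harmonic_sum R #|` A|%fset * harmonic_sum R #|` S|%fset))
   + n * n * nS <= 9 * h ^+ 2 * (n ^+ 2 * nS ^+ 2).
  apply: moment_bound => //; rewrite ?harmonic_sum_ge0 ?harmonic_le_h ?card_shifted_products_le //.
  by rewrite -expr2 ler_wpM2l ?exprn_ge0 // natr_le_sq.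
have nn0 : 0 <= n ^+ 2 * (n * n * nS) by rewrite !mulr_ge0 ?exprn_ge0.
move=> /le_trans /(_ (ler_wpM2l nn0 step)) main.
apply: le_trans (_ : (b ^+ 2 * Y) ^+ 2 <= _).
  rewrite lerXn2r ?nnegrE ?mulr_ge0 ?exprn_ge0 ?(ltW b_gt0) //.
  by rewrite ler_wpM2l // exprn_ge0 // ltW.
apply: le_trans main _.
have -> : n ^+ 2 * (n * n * nS) * (9 * h ^+ 2 * (n ^+ 2 * nS ^+ 2)) =
  9 * h ^+ 2 * n ^+ 6 * nS ^+ 3 by ring.
rewrite ler_wpM2l ?mulr_ge0 ?exprn_ge0 // lerXn2r ?nnegrE //.
Qed.

(** * Solutions of x(y + a) = x'(y' + a) with popular products and quotients *)

Let P := [seq (x, y) | x <- enum_fset A, y <- enum_fset A].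

Let P_A p : p \in P -> p.1 \in A /\ p.2 \in A.
Proof. by case/allpairsP => [[a y]] /= [aA yA ->]. Qed.

Let T := [seq p <- P | (p.1 \in A') && (p.1 * p.2 \in B)].

Let T_A p : p \in T -> p.1 \in A /\ p.2 \in A.
Proof. by rewrite mem_filter => /andP[_]; apply: P_A. Qed.

Let sum_T (F : R * R -> R) : \sum_(p <- T) F p =
  \sum_(x <- A') \sum_(y <- A) (x * y \in B)%:R * F (x, y).
Proof.
rewrite big_filter big_mkcond big_allpairs big_fset /= [RHS]big_mkcond.
rewrite big_seq [RHS]big_seq; apply: eq_bigr => x xA.
rewrite !inE /= xA /=; case: ifP => _ /=; last by rewrite big1.
by apply: eq_bigr => y _; case: ifP; rewrite ?mul1r ?mul0r.
Qed.

Let size_T : t / 2 <= (size T)%:R.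
Proof.
have -> : (size T)%:R = \sum_(x <- A') deg x.
  transitivity (\sum_(p <- T) 1 : R).
    by rewrite big_const_seq count_predT iter_addr addr0.
  by rewrite sum_T; apply: eq_bigr => x _; apply: eq_bigr => y _; rewrite mulr1.
suff : t <= t / 2 + \sum_(x <- A') deg x by lra.
rewrite -{1}sum_deg (big_fsetID _ (fun x => t / (2 * n) <= deg x)) /= addrC lerD2r.
apply: le_trans (_ : \sum_(x <- A) t / (2 * n) <= _); last first.
  rewrite big_const_seq count_predT iter_addr addr0 -mulr_natl.
  by rewrite le_eqVlt; apply/orP; left; apply/eqP; field; rewrite gt_eqF.
rewrite big_fset /= [leLHS]big_mkcond; apply: ler_sum => x _; case: ifP.
  by rewrite -ltNge => /ltW.
by move=> _; rewrite divr_ge0 ?mulr_ge0 // ltW.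
Qed.

Let rho e : R := \sum_(x <- A') ((x + e \in A') && good (x / (x + e)))%:R.

Let Ed := [fset x' - x | x' in A', x in A']%fset.

Let sum_good_pairs (F : R -> R) :
  \sum_(x <- A') \sum_(x' <- A' | good (x / x')) F (x' - x) = \sum_(e <- Ed) rho e * F e.
Proof.
under [RHS]eq_bigr do rewrite mulr_suml.
rewrite [RHS]exchange_big /= big_seq [RHS]big_seq; apply: eq_bigr => x xA'.
rewrite -big_filter (sum_fiber (t := Ed) (h := fun x' => x' - x)) ?fset_uniq //; last first.
  by move=> x'; rewrite mem_filter => /andP[_ x'A]; apply/imfset2P; exists x' => //; exists x.
apply: eq_bigr => e _; congr (_ * _).
rewrite big_filter big_mkcond /=.
transitivity (\sum_(x' <- A') (x + e == x')%:R * (good (x / (x + e)))%:R : R).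
  apply: eq_bigr => x' _.
  have -> : (x' - x == e) = (x + e == x').
    by rewrite eq_sym [in RHS]addrC; apply/eqP/eqP => [->|<-]; rewrite ?subrK ?addrK.
  by case: eqP => [->|]; case: ifP; rewrite ?mulr1 ?mul0r // mulr0.
by rewrite -mulr_suml sum_eq_mem ?fset_uniq // -natrM mulnb.
Qed.

(** The right side is Q^2, where Q is half of the n t^2 / (4s) solutions that the collisions
    guarantee; this is what makes the rare quotients affordable. *)
Hypothesis D_le : D * (c1 * n ^+ 6 * h ^+ 2) <= (n * t ^+ 2 / (8 * s)) ^+ 2.

Let s_gt0 : 0 < s. Proof. exact: lt_le_trans s_ge1. Qed.

(* Solutions of x(y + a) = x'(y' + a) whose ratio x/x' is a rare quotient of A
   are controlled by the collinearity bound. *)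
Let bad_solutions :
  \sum_(x <- A) \sum_(x' <- A) (~~ good (x / x'))%:R * shift_quot_reps A (x / x')
    <= n * t ^+ 2 / (8 * s).
Proof.
rewrite (sum_quotients (fun m => (~~ good m)%:R * shift_quot_reps A m) A_unit (fset_uniq M) mem_M).
set X := \sum_(m <- M) _.
have X0 : 0 <= X.
  by apply: sumr_ge0 => m _; rewrite !mulr_ge0 ?quot_reps_ge0 ?shift_quot_reps_ge0.
have Q0 : 0 <= n * t ^+ 2 / (8 * s) by rewrite divr_ge0 ?mulr_ge0 ?exprn_ge0 // ltW.
rewrite -ler_sqr ?nnegrE //; apply: le_trans D_le.
have -> : X = \sum_(m <- M) (quot_reps A m * (~~ good m)%:R) * shift_quot_reps A m.
  by apply: eq_bigr => m _; rewrite mulrA.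
apply: le_trans (sum_CauchySchwarz _ _ _) _.
have -> : D * (c1 * n ^+ 6 * h ^+ 2) = (D * n ^+ 2) * (c1 * n ^+ 4 * h ^+ 2) by ring.
apply: ler_pM => //.
- by apply: sumr_ge0 => m _; rewrite exprn_ge0 // mulr_ge0 ?quot_reps_ge0.
- by apply: sumr_ge0 => m _; rewrite exprn_ge0 // shift_quot_reps_ge0.
apply: le_trans (_ : \sum_(m <- M) quot_reps A m * D <= _).
  apply: ler_sum => m _; rewrite exprMn expr2 -mulrA ler_wpM2l ?quot_reps_ge0 //.
  rewrite /good -ltNge; case: ltP => [/ltW mD|_]; first by rewrite expr1n mulr1.
  by rewrite expr0n mulr0 ltW.
rewrite -(sum_quotients (fun=> D) A_unit (fset_uniq M) mem_M).
rewrite le_eqVlt; apply/orP; left; apply/eqP.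
under eq_bigr do rewrite big_const_seq count_predT iter_addr addr0 -mulr_natl.
by rewrite big_const_seq count_predT iter_addr addr0 -mulr_natl; ring.
Qed.

Let Q := n * t ^+ 2 / (8 * s).

(** By xy - x'y' = a(x' - x), a solution represents a(x' - x) as a difference of two elements of
    [B], and [rho e] counts the popular pairs with x' - x = e. Collisions give at least 2Q
    solutions, rare quotients at most Q. *)
Lemma popular_solutions_lower_bound :
  Q <= \sum_(a <- A) \sum_(e <- Ed) rho e * dif_reps B B (a * e).
Proof.
have -> : \sum_(a <- A) \sum_(e <- Ed) rho e * dif_reps B B (a * e) =
  \sum_(a <- A) \sum_(x <- A') \sum_(x' <- A' | good (x / x')) dif_reps B B (a * (x' - x)).
  by apply: eq_bigr => a _; rewrite (sum_good_pairs (fun e => dif_reps B B (a * e))).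
set G := \sum_(a <- A) _.
have coll := shifted_collisions T_A.
set C := \sum_(a <- A) _ in coll.
suff CG : C <= Q + G.
  have T2 : (t / 2) ^+ 2 <= (size T)%:R ^+ 2.
    by rewrite lerXn2r ?nnegrE ?size_T // divr_ge0 // ltW.
  have h1 : n * (t / 2) ^+ 2 <= s * (Q + G).
    apply: le_trans (le_trans coll _); first by rewrite ler_wpM2l.
    by rewrite ler_wpM2l.
  have : s * (2 * Q) = n * (t / 2) ^+ 2 by rewrite /Q; field; rewrite gt_eqF.
  move=> e; rewrite -e ler_pM2l // in h1.
  lra.
pose q a x x' : R := \sum_(y <- A) \sum_(y' <- A)
  (x * y \in B)%:R * (x' * y' \in B)%:R * (x * (y + a) == x' * (y' + a))%:R.
have q0 a x x' : 0 <= q a x x'.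
  by apply: sumr_ge0 => y _; apply: sumr_ge0 => y' _; rewrite !mulr_ge0.
have -> : C = \sum_(a <- A) \sum_(x <- A') \sum_(x' <- A') q a x x'.
  apply: eq_bigr => a _; rewrite sum_T; apply: eq_bigr => x _.
  rewrite /q [RHS]exchange_big /=; apply: eq_bigr => y _.
  rewrite sum_T mulr_sumr; apply: eq_bigr => x' _.
  by rewrite mulr_sumr; apply: eq_bigr => y' _; rewrite mulrA.
apply: le_trans (_ : \sum_(a <- A) \sum_(x <- A') \sum_(x' <- A')
   ((~~ good (x / x'))%:R * q a x x' +
     (if good (x / x') then dif_reps B B (a * (x' - x)) else 0)) <= _).
  apply: ler_sum => a _; apply: ler_sum_seq => x /A'A[xA _] _.
  apply: ler_sum_seq => x' /A'A[x'A _] _.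
  case: ifP => _ /=; last by rewrite mul1r addr0.
  rewrite mul0r add0r /dif_reps /q.
  have -> : \sum_(y <- A) \sum_(y' <- A)
     (x * y \in B)%:R * (x' * y' \in B)%:R * (x * (y + a) == x' * (y' + a))%:R =
     \sum_(y <- A | x * y \in B) \sum_(y' <- A)
       (x' * y' \in B)%:R * (x * (y + a) == x' * (y' + a))%:R :> R.
    rewrite [RHS]big_mkcond; apply: eq_bigr => y _; case: ifP => _.
      by apply: eq_bigr => y' _; rewrite mul1r.
    by rewrite big1 // => y' _; rewrite !mul0r.
  apply: (@ler_sum_inj _ _ _ _ _ _ (fun y => x * y)) => //; try exact: fset_uniq.
  - by move=> y z _ _ _ _ /mulfI; apply; apply: A_unit.
  move=> y yA xyB.
  apply: le_trans (_ : \sum_(y' <- A) (x * y - a * (x' - x) == x' * y')%:R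
     * (x' * y' \in B)%:R <= _).
    apply: ler_sum => y' _; rewrite mulrC ler_wpM2r //.
    rewrite ler_nat; case: eqP => [e|//]; case: eqP => // ne; case: ne; lra.
  have -> : \sum_(y' <- A) (x * y - a * (x' - x) == x' * y')%:R * (x' * y' \in B)%:R =
    \sum_(y' <- A) ((x * y - a * (x' - x)) / x' == y')%:R * (x' * y' \in B)%:R :> R.
    apply: eq_bigr => y' _; congr (_ %:R * _); congr nat_of_bool.
    apply/eqP/eqP => [->|<-]; first by rewrite [x' * y']mulrC mulfK ?A_unit.
    by rewrite [RHS]mulrC divfK ?A_unit.
  rewrite (sum_indic _ (fun y' => (x' * y' \in B)%:R)) ?fset_uniq //.
  rewrite mulrC [x' * _]mulrC divfK ?A_unit //.
  by rewrite -natrM mulnb ler_nat; case: (_ \in B) => //=; case: (_ \in A).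
under eq_bigr => a _ do under eq_bigr => x _ do rewrite big_split /=.
under eq_bigr => a _ do rewrite big_split /=.
rewrite big_split /=; apply: lerD; last first.
  by apply: ler_sum => a _; apply: ler_sum => x _; rewrite [leRHS]big_mkcond.
apply: le_trans bad_solutions.
rewrite exchange_big /=.
under eq_bigr => x _ do rewrite exchange_big /=.
apply: le_trans (_ : \sum_(x <- A') \sum_(x' <- A') (~~ good (x / x'))%:R * shift_quot_reps A (x / x') <= _).
  apply: ler_sum_seq => x _ _; apply: ler_sum_seq => x' /A'A[x'A _] _.
  rewrite -mulr_sumr ler_wpM2l // shift_quot_repsE ?A_unit //.
  apply: ler_sum => a _; apply: ler_sum => y _; apply: ler_sum => y' _.
  by rewrite -[leRHS]mul1r ler_wpM2r // -natrM mulnb lern1 leq_b1.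
have sub (F : R -> R) : (forall x, 0 <= F x) -> \sum_(x <- A') F x <= \sum_(x <- A) F x.
  move=> F0; apply: ler_sum_sub => [|x /A'A[]//|x _]; last exact: F0.
  exact: fset_uniq.
have pos x x' : 0 <= (~~ good (x / x'))%:R * shift_quot_reps A (x / x').
  by rewrite mulr_ge0 ?shift_quot_reps_ge0.
apply: le_trans (sub _ _) _ => [x|]; first by apply: sumr_ge0.
by apply: ler_sum => x _; apply: sub.
Qed.
(** The pairs (x, y) for which both factors of (x + e)(xy/(x + e) + a) come from A, so that x(y + a)
    + ae stays in A(A + a). *)
Let W e := [seq p <- P | [&& p.1 \in A', p.1 + e \in A', good (p.1 / (p.1 + e))
  & p.1 * p.2 / (p.1 + e) \in A]].

Let En a e : R := \sum_(p <- W e) \sum_(q <- W e) (p.1 * (p.2 + a) == q.1 * (q.2 + a))%:R.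

Let sum_W e (F : R * R -> R) : \sum_(p <- W e) F p =
  \sum_(x <- A') ((x + e \in A') && good (x / (x + e)))%:R *
     \sum_(y <- A) (x * y / (x + e) \in A)%:R * F (x, y).
Proof.
rewrite big_filter big_mkcond big_allpairs [RHS]big_fset /= [RHS]big_mkcond.
rewrite big_seq [RHS]big_seq; apply: eq_bigr => x xA.
have -> : (t / (2 * n) <= deg x) = (x \in A') by rewrite !inE xA.
case: (x \in A') => /=; last by rewrite big1.
rewrite mulr_sumr; apply: eq_bigr => y _.
by case: (x + e \in A'); case: (good _); case: (_ \in A); rewrite /= ?mul1r ?mul0r.
Qed.

(** Popularity of x/(x + e) supplies at least [D] admissible y for each x counted by [rho e]; this
    is why rare quotients had to be removed. *)
Let size_W e : D * rho e <= (size (W e))%:R.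
Proof.
have -> : (size (W e))%:R = \sum_(p <- W e) 1 :> R.
  by rewrite big_const_seq count_predT iter_addr addr0.
rewrite sum_W mulr_sumr; apply: ler_sum => x _.
rewrite mulrC; case: (boolP (_ && _)) => [/andP[_ gx]|_]; last by rewrite !mul0r.
rewrite !mul1r; apply: le_trans gx _; apply: ler_sum => y _.
by rewrite mulr1 mulrAC.
Qed.

(* The Katz-Koester step: translating by a * e maps a large part of A(A + a)
   into A(A + a), because x(y + a) + ae = (x + e)(xy/(x + e) + a). *)
Let shifts_of_products a e : a \in A ->
  (D * rho e) ^+ 2 <=
    dif_reps (shifted_products a) (shifted_products a) (a * e) * En a e.
Proof.
move=> aA; set S := shifted_products a.
have rho0 : 0 <= rho e by apply: sumr_ge0.
apply: le_trans (_ : (size (W e))%:R ^+ 2 <= _).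
  by rewrite lerXn2r ?nnegrE ?size_W // mulr_ge0 // ltW.
pose L := [seq u <- enum_fset S | u - a * e \in S].
have -> : dif_reps S S (a * e) = (size L)%:R.
  rewrite /dif_reps size_filter -sum1_count natr_sum [RHS]big_mkcond.
  by apply: eq_bigr => u _; case: ifP.
have -> : En a e = \sum_(p <- W e) \sum_(q <- W e)
   (p.1 * (p.2 + a) + a * e == q.1 * (q.2 + a) + a * e)%:R.
  by apply: eq_bigr => p _; apply: eq_bigr => q _; rewrite (inj_eq (addIr _)).
apply: (@size_sq_le_collisions _ _ _ _ _ (fun p => p.1 * (p.2 + a) + a * e)).
  by rewrite filter_uniq // fset_uniq.
move=> p; rewrite !mem_filter => /andP[/and4P[/A'A[xA _] /A'A[xeA _] _ yA] /P_A[_ pA]].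
rewrite addrK mem_shifted_products //=.
have -> : p.1 * (p.2 + a) + a * e = (p.1 + e) * (p.1 * p.2 / (p.1 + e) + a).
  by field; apply: A_unit.
exact: mem_shifted_products.
Qed.

Let V := \sum_(x <- A') \sum_(x1 <- A') shift_quot_reps A (x / x1) * dif_reps A' A' (x1 - x).

(** Only x + e and x1 + e in A' are retained from the definition of [W]. For given x and x1, such e
    number at most the representations of x1 - x, while a, y, y1 contribute N(x/x1). *)
Let sum_En : \sum_(a <- A) \sum_(e <- Ed) En a e <= V.
Proof.
apply: le_trans (_ : \sum_(a <- A) \sum_(e <- Ed) \sum_(x <- A') \sum_(x1 <- A')
   ((x + e \in A')%:R * (x1 + e \in A')%:R) *
   (\sum_(y <- A) \sum_(y1 <- A) (x * (y + a) == x1 * (y1 + a))%:R) <= _).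
  apply: ler_sum => a _; apply: ler_sum => e _.
  have le_W (G : R * R -> R) : (forall p, 0 <= G p) -> \sum_(p <- W e) G p <=
      \sum_(x <- A') (x + e \in A')%:R * \sum_(y <- A) G (x, y).
    move=> G0; rewrite sum_W; apply: ler_sum => x _; apply: ler_pM => //.
    - by apply: sumr_ge0 => y _; rewrite mulr_ge0.
    - by rewrite ler_nat; case: (_ \in A'); case: (good _).
    apply: ler_sum => y _; rewrite -[leRHS]mul1r ler_wpM2r //.
    by rewrite lern1 leq_b1.
  apply: le_trans (le_W _ _) _; first by move=> p; apply: sumr_ge0.
  apply: ler_sum => x _; rewrite mulr_sumr.
  under [leRHS]eq_bigr do rewrite -mulrA.
  rewrite -mulr_sumr -mulr_sumr ler_wpM2l //.
  under [leRHS]eq_bigr do rewrite mulr_sumr.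
  rewrite [leRHS]exchange_big /=; apply: ler_sum => y _.
  by apply: (le_W (fun q => (x * (y + a) == q.1 * (q.2 + a))%:R)).
rewrite exchange_big /=.
under eq_bigr => e _ do rewrite exchange_big /=.
under eq_bigr => e _ do under eq_bigr => x _ do rewrite exchange_big /=.
rewrite exchange_big /=; apply: ler_sum_seq => x /A'A[xA _] _.
rewrite exchange_big /=; apply: ler_sum_seq => x1 /A'A[x1A _] _.
under eq_bigr => e _ do rewrite -mulr_sumr.
rewrite -mulr_suml -shift_quot_repsE ?A_unit // mulrC ler_wpM2l ?shift_quot_reps_ge0 //.
have -> : \sum_(e <- Ed) (x + e \in A')%:R * (x1 + e \in A')%:R =
   \sum_(e <- Ed | x1 + e \in A') (x + e \in A')%:R :> R.
  by rewrite [RHS]big_mkcond; apply: eq_bigr => e _; case: ifP; rewrite ?mulr1 ?mulr0.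
apply: (@ler_sum_inj _ _ _ _ _ _ (fun e => x1 + e)) => //; try exact: fset_uniq.
- by move=> e e' _ _ _ _ /addrI.
- by move=> e _ _; have -> : x1 + e - (x1 - x) = x + e by ring.
Qed.

Let E3A := \sum_(f <- Ed) dif_reps A' A' f ^+ 3.

(** Cauchy-Schwarz separates the multiplicative and the additive factor. The first costs n, as a
    quotient has at most n representations; summing r(x1 - x)^2 over pairs gives the third moment of
    r. *)
Let V_sq_le : V ^+ 2 <= c1 * h ^+ 2 * n ^+ 5 * E3A.
Proof.
pose PA := [seq (x, y) | x <- enum_fset A', y <- enum_fset A'].
have sub (F : R -> R) : (forall x, 0 <= F x) -> \sum_(x <- A') F x <= \sum_(x <- A) F x.
  move=> F0; apply: ler_sum_sub => [|x /A'A[]//|x _]; last exact: F0.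
  exact: fset_uniq.
have -> : V = \sum_(p <- PA) shift_quot_reps A (p.1 / p.2) * dif_reps A' A' (p.2 - p.1).
  by rewrite big_allpairs.
apply: le_trans (sum_CauchySchwarz _ _ _) _; rewrite !big_allpairs /=.
apply: ler_pM.
- by apply: sumr_ge0 => x _; apply: sumr_ge0 => y _; rewrite exprn_ge0 ?shift_quot_reps_ge0.
- by apply: sumr_ge0 => x _; apply: sumr_ge0 => y _; rewrite exprn_ge0 ?dif_reps_ge0.
- apply: le_trans (_ : \sum_(x <- A) \sum_(y <- A) shift_quot_reps A (x / y) ^+ 2 <= _).
    apply: le_trans (sub _ _) _ => [x|].
      by apply: sumr_ge0 => y _; rewrite exprn_ge0 ?shift_quot_reps_ge0.
    by apply: ler_sum => x _; apply: sub => y; rewrite exprn_ge0 ?shift_quot_reps_ge0.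
  rewrite (sum_quotients (fun m => shift_quot_reps A m ^+ 2) A_unit (fset_uniq M) mem_M).
  apply: le_trans (_ : \sum_(m <- M) n * shift_quot_reps A m ^+ 2 <= _).
    by apply: ler_sum => m _; rewrite ler_wpM2r ?quot_reps_le // exprn_ge0 ?shift_quot_reps_ge0.
  have -> : c1 * h ^+ 2 * n ^+ 5 = n * (c1 * n ^+ 4 * h ^+ 2) by ring.
  by rewrite -mulr_sumr ler_wpM2l.
rewrite exchange_big /= (sum_differences (K := Ed) (fun f => dif_reps A' A' f ^+ 2)).
- by rewrite le_eqVlt; apply/orP; left; apply/eqP; apply: eq_bigr => f _; rewrite -exprS.
- exact: fset_uniq.
- by move=> u v uA vA; apply/imfset2P; exists u => //; exists v.
Qed.

(** Let r and S count representations of ae by differences of [B] and of A(A + a). By (D rho)^2 <= S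
    En one has (rho r)^3 <= D^-2 (r S) En (rho r^2), and Hoelder's inequality sums the three factors
    separately, to D^-2 Z, at most V and at most n(X + Y). *)
Lemma popular_moment_inequality : exists Z V X Y : R,
  [/\ Q ^+ 3 * D ^+ 2 <= Z * V * (n * (X + Y)),
      [/\ 0 <= Z, 0 <= V, 0 <= X & 0 <= Y],
      (b ^+ 2 * Z) ^+ 2 <= 9 * h ^+ 2 * n ^+ 8 * s ^+ 3,
      V ^+ 2 <= c1 * h ^+ 2 * n ^+ 5 * X
    & t * b ^+ 2 * X <= 72 * h ^+ 2 * n ^+ 7 /\
      b ^+ 5 * Y <= 9 * h ^+ 2 * n ^+ 4 * t ^+ 2].
Proof.
pose za a := \sum_(e <- Ed) dif_reps B B (a * e)
   * dif_reps (shifted_products a) (shifted_products a) (a * e).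
pose Z := \sum_(a <- A) za a.
have rho0 e : 0 <= rho e by apply: sumr_ge0.
have rho_le e : rho e <= dif_reps A' A' e.
  rewrite /rho.
  have -> : \sum_(x <- A') ((x + e \in A') && good (x / (x + e)))%:R =
    \sum_(x <- A' | (x + e \in A') && good (x / (x + e))) 1 :> R.
    by rewrite [RHS]big_mkcond; apply: eq_bigr => x _; case: ifP.
  apply: (@ler_sum_inj _ _ _ _ _ _ (fun x => x + e)) => //; try exact: fset_uniq.
  - by move=> x _ /andP[].
  - by move=> x y _ _ _ _ /addIr.
  - by move=> x xA' _; rewrite addrK xA'.
pose Fa a := [fset a * e | e in Ed]%fset.
have sum_Fa a (F : R -> R) : a \in A -> \sum_(e <- Ed) F (a * e) = \sum_(f <- Fa a) F f.
  by move=> aA; rewrite big_imfset //= => x y _ _ /mulfI; apply; apply: A_unit.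
pose Ya a := \sum_(f <- Fa a) dif_reps B B f ^+ 3.
(* The dilated differences [Fa a] vary with a, so [Y] is a bound uniform in a and not itself a
   moment. *)
pose Y := 9 * h ^+ 2 * n ^+ 4 * t ^+ 2 / b ^+ 5.
have Ya_le a : a \in A -> Ya a <= Y.
  by move=> aA; rewrite ler_pdivlMr ?exprn_gt0 // mulrC dif_reps_B_third_moment.
have za0 a : 0 <= za a by apply: sumr_ge0 => e _; rewrite mulr_ge0 ?dif_reps_ge0.
have En0 a e : 0 <= En a e by apply: sumr_ge0 => p _; apply: sumr_ge0.
have X0 : 0 <= E3A by apply: sumr_ge0 => e _; rewrite exprn_ge0 ?dif_reps_ge0.
have Y0 : 0 <= Y by rewrite divr_ge0 ?mulr_ge0 ?exprn_ge0 // ltW.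
exists Z, V, E3A, Y; split.
- pose L := [seq (a, e) | a <- enum_fset A, e <- enum_fset Ed].
  have Q0 : 0 <= Q by rewrite divr_ge0 ?mulr_ge0 ?exprn_ge0 // ltW.
  pose F (p : R * R) := rho p.2 * dif_reps B B (p.1 * p.2).
  have QF : Q <= \sum_(p <- L) F p by rewrite big_allpairs popular_solutions_lower_bound.
  have D20 : 0 < D ^+ 2 by rewrite exprn_gt0.
  have b0 f : 0 <= dif_reps B B f by apply: dif_reps_ge0.
  have hold : (\sum_(p <- L) F p) ^+ 3 <=
    (\sum_(p <- L) D ^- 2 * (dif_reps B B (p.1 * p.2)
      * dif_reps (shifted_products p.1) (shifted_products p.1) (p.1 * p.2)))
    * (\sum_(p <- L) En p.1 p.2) * (\sum_(p <- L) rho p.2 * dif_reps B B (p.1 * p.2) ^+ 2).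
    apply: holder3 => p /allpairsP[[a e] /= [aA eE ->]] /=.
    split; rewrite ?mulr_ge0 ?invr_ge0 ?exprn_ge0 ?dif_reps_ge0 ?(ltW D20) ?(ltW D_gt0) //.
    rewrite /F /=.
    have KK := shifts_of_products e aA.
    set S := dif_reps (shifted_products a) _ _ in KK *.
    set be := dif_reps B B _.
    have -> : D ^- 2 * (be * S) * En a e * (rho e * be ^+ 2) =
       D ^- 2 * (rho e * be ^+ 3) * (S * En a e) by ring.
    have -> : (rho e * be) ^+ 3 = D ^- 2 * (rho e * be ^+ 3) * ((D * rho e) ^+ 2).
      by field; rewrite gt_eqF.
    by rewrite ler_wpM2l // !mulr_ge0 ?invr_ge0 ?exprn_ge0 ?b0 ?(ltW D_gt0).
  have : Q ^+ 3 <= (\sum_(p <- L) F p) ^+ 3.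
    by rewrite lerXn2r ?nnegrE // (le_trans Q0).
  move=> /le_trans /(_ hold); rewrite !big_allpairs /=.
  have -> : \sum_(a <- A) \sum_(e <- Ed) D ^- 2 * (dif_reps B B (a * e)
      * dif_reps (shifted_products a) (shifted_products a) (a * e)) = D ^- 2 * Z.
    by rewrite /Z mulr_sumr; apply: eq_bigr => a _; rewrite mulr_sumr.
  move=> hQ.
  have Z0 : 0 <= Z by apply: sumr_ge0.
  have -> : Z * V * (n * (E3A + Y)) = (D ^- 2 * Z * V * (n * (E3A + Y))) * D ^+ 2.
    by field; rewrite gt_eqF.
  rewrite ler_wpM2r ?(ltW D20) //; apply: le_trans hQ _.
  apply: ler_pM.
  + rewrite !mulr_ge0 ?invr_ge0 ?(ltW D20) //.
    by apply: sumr_ge0 => a _; apply: sumr_ge0.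
  + by apply: sumr_ge0 => a _; apply: sumr_ge0 => e _; rewrite mulr_ge0 ?exprn_ge0.
  + by rewrite ler_wpM2l ?mulr_ge0 ?invr_ge0 ?(ltW D20).
  apply: le_trans (_ : \sum_(a <- A) (E3A + Y) <= _); last first.
    by rewrite big_const_seq count_predT iter_addr addr0 mulr_natl.
  apply: ler_sum_seq => a aA _.
  apply: le_trans (_ : E3A + Ya a <= _); last by rewrite lerD2l Ya_le.
  rewrite /Ya -(sum_Fa a (fun f => dif_reps B B f ^+ 3)) // -big_split /=.
  apply: ler_sum => e _.
  have r3 : rho e ^+ 3 <= dif_reps A' A' e ^+ 3.
    by rewrite lerXn2r ?nnegrE ?dif_reps_ge0.
  apply: le_trans (_ : rho e ^+ 3 + dif_reps B B (a * e) ^+ 3 <= _); last by rewrite lerD2r.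
  (* What remains is u v^2 <= u^3 + v^3, true because u v^2 <= max(u, v)^3. *)
  have := rho0 e; have := b0 (a * e); move: (rho e) (dif_reps B B _) => u v v0 u0.
  have [uv|/ltW vu] := lerP u v.
    rewrite -[leLHS]add0r lerD ?exprn_ge0 // [leRHS]exprS ler_wpM2r ?exprn_ge0 //.
  rewrite -[leLHS]addr0 lerD ?exprn_ge0 // [leRHS]exprS ler_wpM2l //.
  by rewrite lerXn2r ?nnegrE.
- split=> //; first by apply: sumr_ge0.
  apply: sumr_ge0 => x _; apply: sumr_ge0 => y _.
  by rewrite mulr_ge0 ?shift_quot_reps_ge0 ?dif_reps_ge0.
- have za_sq a : a \in A -> (b ^+ 2 * za a) ^+ 2 <= 9 * h ^+ 2 * n ^+ 6 * s ^+ 3.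
    move=> aA; rewrite /za (sum_Fa a (fun f => dif_reps B B f
      * dif_reps (shifted_products a) (shifted_products a) f)) //.
    exact: dif_reps_mul_bound (fset_uniq _).
  rewrite /Z mulr_sumr; apply: le_trans (sum_sq_le _ _) _.
  apply: le_trans (_ : n * \sum_(a <- A) 9 * h ^+ 2 * n ^+ 6 * s ^+ 3 <= _).
    by rewrite ler_wpM2l //; apply: ler_sum_seq => a aA _; apply: za_sq.
  rewrite big_const_seq count_predT iter_addr addr0 -mulr_natl.
  by rewrite le_eqVlt; apply/orP; left; apply/eqP; ring.
- exact: V_sq_le.
split; first exact: dif_reps_A'_third_moment.
by rewrite le_eqVlt; apply/orP; left; apply/eqP; rewrite /Y; field; rewrite gt_eqF.
Qed.
End Popular.

Lemma growth_bound : n ^+ 140 <= (2 ^+ 13 * h ^+ 2 * s) ^+ 93.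
Proof.
have [B [b [b1 bn Bb Elog]]] := dyadic_product_set (fset_uniq K) A_neq0.
set t := \sum_(u <- B) prod_reps A u in Elog.
have s1 := growth_ge1.
have s0 : 0 < s by apply: lt_le_trans s1.
have h0 : 0 < h by apply: lt_le_trans h_ge1.
have b0 : 0 < b by apply: lt_le_trans b1.
have E_le : E <= h * (2 * b * t).
  rewrite /E (quot_energyE A_unit (fset_uniq M) (fset_uniq K) mem_M mem_K).
  apply: le_trans Elog _; rewrite ler_wpM2r // !mulr_ge0 ?(ltW b0) //.
  by apply: sumr_ge0 => u _; apply: sumr_ge0.
have E0 : 0 < E.
  have := lt_le_trans (exprn_gt0 6 n_gt0) energy_lower_bound.
  by rewrite pmulr_rgt0 // !mulr_gt0 ?exprn_gt0 // /c1.
have t0 : 0 < t.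
  have := lt_le_trans E0 E_le; rewrite pmulr_rgt0 // pmulr_rgt0 //.
  by rewrite mulr_gt0.
(* This gives equality in [D_le]: 2^13 = 8^2 * 128. The same number serves below as [c], being
   larger than the other constants 256, 128, 72, 9 and 8. *)
pose D := t ^+ 4 / (2 ^+ 13 * n ^+ 4 * h ^+ 2 * s ^+ 2).
have D0 : 0 < D by rewrite divr_gt0 ?mulr_gt0 ?exprn_gt0.
have D_le : D * (c1 * n ^+ 6 * h ^+ 2) <= (n * t ^+ 2 / (8 * s)) ^+ 2.
  rewrite le_eqVlt; apply/orP; left; apply/eqP; rewrite /D /c1; field.
  by rewrite !gt_eqF.
have [Z [V [X [Y [main [Z0 V0 X0 Y0] HZ HV [HX HY]]]]]] :=
  @popular_moment_inequality B b D b1 Bb D0 t0 D_le.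
rewrite -/t in main HX HY.
have t_ge0 : 0 <= t by apply: ltW.
have s_ge0 : 0 <= s by apply: ltW.
pose c : R := 2 ^+ 13.
have c_ge : 256 <= c by rewrite /c !exprS expr0; lra.
have c_ge0 : 0 <= c by lra.
have mono k x : 0 <= x -> k <= 256 -> k * x <= c * x.
  by move=> x0 kle; rewrite ler_wpM2r //; lra.
apply: (@growth_arithmetic R n s h b t c Z V X Y) => //.
- lra.
- apply: le_trans energy_lower_bound _.
  apply: le_trans (_ : c1 * h ^+ 2 * s ^+ 2 * (h * (2 * b * t)) <= _).
    by rewrite ler_wpM2l // !mulr_ge0 ?exprn_ge0 ?(ltW h0) ?(ltW s0) // /c1.
  have -> : c1 * h ^+ 2 * s ^+ 2 * (h * (2 * b * t)) = 256 * (h ^+ 3 * s ^+ 2 * (b * t)).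
    by rewrite /c1; ring.
  have -> : c * h ^+ 3 * s ^+ 2 * (b * t) = c * (h ^+ 3 * s ^+ 2 * (b * t)) by ring.
  by apply: mono => //; rewrite !mulr_ge0 ?exprn_ge0 ?(ltW h0) ?(ltW s0) ?(ltW b0) ?(ltW t0).
- apply: le_trans main; rewrite ler_wpM2r ?sqr_ge0 //.
  have q0 : 0 <= n * t ^+ 2 by rewrite mulr_ge0 ?sqr_ge0.
  rewrite lerXn2r ?nnegrE ?divr_ge0 ?mulr_ge0 ?exprn_ge0 //.
  rewrite ler_wpM2l // lef_pV2 ?posrE ?mulr_gt0 //.
  by apply: mono => //; lra.
- apply: le_trans HZ _.
  have -> : 9 * h ^+ 2 * n ^+ 8 * s ^+ 3 = 9 * (h ^+ 2 * n ^+ 8 * s ^+ 3) by ring.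
  have -> : c * h ^+ 2 * n ^+ 8 * s ^+ 3 = c * (h ^+ 2 * n ^+ 8 * s ^+ 3) by ring.
  by apply: mono; [rewrite !mulr_ge0 ?exprn_ge0 ?(ltW h0)|lra].
- apply: le_trans HV _.
  have -> : c1 * h ^+ 2 * n ^+ 5 * X = c1 * (h ^+ 2 * n ^+ 5 * X) by ring.
  have -> : c * h ^+ 2 * n ^+ 5 * X = c * (h ^+ 2 * n ^+ 5 * X) by ring.
  by apply: mono; [rewrite !mulr_ge0 ?exprn_ge0 ?(ltW h0)|rewrite /c1; lra].
- apply: le_trans HX _.
  have -> : 72 * h ^+ 2 * n ^+ 7 = 72 * (h ^+ 2 * n ^+ 7) by ring.
  have -> : c * h ^+ 2 * n ^+ 7 = c * (h ^+ 2 * n ^+ 7) by ring.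
  by apply: mono; [rewrite !mulr_ge0 ?exprn_ge0 ?(ltW h0)|lra].
apply: le_trans HY _.
have -> : 9 * h ^+ 2 * n ^+ 4 * t ^+ 2 = 9 * (h ^+ 2 * n ^+ 4 * t ^+ 2) by ring.
have -> : c * h ^+ 2 * n ^+ 4 * t ^+ 2 = c * (h ^+ 2 * n ^+ 4 * t ^+ 2) by ring.
by apply: mono; [rewrite !mulr_ge0 ?exprn_ge0 ?(ltW h0)|lra].
Qed.
End Growth.
End KatzKoester.

(** * Logarithmic bounds and the passage to real exponents *)

Section LogBounds.
Variable R : realType.

Lemma harmonic_sum_le_ln (k : nat) : (0 < k)%N ->
  harmonic_sum R k <= 1 + ln (k%:R : R).
Proof.
elim: k => // k IH _; have [->|k0] := posnP k.
  by rewrite /harmonic_sum big_nat1 invr1 ln1 addr0.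
rewrite /harmonic_sum big_nat_recr //= -/(harmonic_sum R k).
have k0R : 0 < k%:R :> R by rewrite ltr0n.
have k1R : 0 < k.+1%:R :> R by rewrite ltr0n.
have e : 1 + - (k.+1%:R)^-1 = k%:R / k.+1%:R :> R.
  have k1n : k.+1%:R != 0 :> R by rewrite gt_eqF.
  by rewrite -[X in X + _](divff k1n) -[X in _ - X]mul1r -mulrBl -natr1 addrK.
have : ln (1 + - (k.+1%:R)^-1 : R) <= - (k.+1%:R)^-1.
  by apply: le_ln1Dx; rewrite ltrN2 invf_lt1 // ltr1n ltnS.
rewrite e lnM ?posrE ?invr_gt0 // lnV ?posrE //.
move: (IH k0); move: (harmonic_sum R k) (ln k%:R) (ln k.+1%:R) (k.+1%:R^-1).
by move=> H x y z; lra.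
Qed.

Lemma trunc_log_ln (k : nat) : (0 < k)%N ->
  (trunc_log 2 k)%:R * ln (2 : R) <= ln (k%:R : R).
Proof.
move=> k0; rewrite mulr_natl -lnXn // ler_ln ?posrE ?exprn_gt0 ?ltr0n //.
by rewrite -natrX ler_nat; apply: trunc_logP.
Qed.

Lemma ln2_bounds : 0 < ln (2 : R) <= 1.
Proof.
rewrite ln_gt0 ?ltr1n //=; have := @le_ln1Dx R 1; apply.
by rewrite (lt_trans (ltrN10 _)).
Qed.

Lemma exists_max_seq (I : eqType) (s : seq I) (f : I -> nat) : s != [::] ->
  exists2 i, i \in s & forall j, j \in s -> (f j <= f i)%N.
Proof.
elim: s => // x s IH _; have [->|sn0] := eqVneq s [::].
  by exists x; rewrite ?mem_head // => j; rewrite mem_seq1 => /eqP->.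
have [i is_ Hi] := IH sn0; have [le|/ltnW le] := leqP (f i) (f x).
  exists x; rewrite ?mem_head // => j; rewrite in_cons => /orP[/eqP->//|/Hi].
  by move=> /leq_trans; apply.
by exists i; rewrite ?in_cons ?is_ ?orbT // => j; rewrite in_cons => /orP[/eqP->|/Hi].
Qed.

(** The element a maximises |A(A + a)|, whose size can then play the role of [s]. [L] is left free
    because the set may be a singleton, with logarithm 0; it will be the logarithm of a larger
    set. *)
Lemma positive_growth (A : {fset R}) (L : R) :
  (forall x, x \in A -> 0 < x) -> (0 < #|` A|%fset)%N -> 1 <= L ->
  ln (#|` A|%fset%:R : R) <= L * ln 2 ->
  exists2 a, a \in A &
    (#|` A|%fset%:R : R) `^ (140 / 93) <=
      2 ^+ 13 * (6 * L) ^+ 2 * #|` shifted_products A a|%fset%:R.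
Proof.
move=> A0 cA L1 lnL; have /andP[l20 l21] := ln2_bounds.
have Ane : enum_fset A != [::] by rewrite -size_eq0 -lt0n.
have [a aA amax] := exists_max_seq (fun a => #|` shifted_products A a|%fset) Ane.
exists a => //; set n := #|` A|%fset in cA lnL *.
have n0 : 0 < n%:R :> R by rewrite ltr0n.
have n1 : 1 <= n%:R :> R by rewrite ler1n.
have lnL' : ln (n%:R : R) <= L.
  by apply: le_trans lnL _; rewrite -[leRHS]mulr1 ler_wpM2l //; lra.
(* The sum is at most 1 + ln 2 + 2 ln n <= 2 + 2L, so 6L leaves room. *)
have harm : harmonic_sum R (2 * n ^ 2) <= 6 * L.
  apply: le_trans (harmonic_sum_le_ln _) _; first by rewrite muln_gt0 expn_gt0 cA.
  rewrite natrM natrX lnM ?posrE ?exprn_gt0 // lnXn // mulr2n; lra.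
have lg : (trunc_log 2 n).+1%:R <= 6 * L.
  have : (trunc_log 2 n)%:R <= L.
    by rewrite -(ler_pM2r l20); apply: le_trans (trunc_log_ln cA) lnL.
  by rewrite -natr1; lra.
have := @growth_bound R A (#|` shifted_products A a|%fset)%:R (6 * L) A0 cA _ harm lg.
set s := (#|` _|%fset)%:R; set u := 2 ^+ 13 * _ * s => main.
have {main} : n%:R ^+ 140 <= u ^+ 93.
  by apply: main => b bA; rewrite ler_nat; apply: amax.
have L0 : 0 <= L by apply: le_trans L1.
have u0 : 0 <= u by rewrite !mulr_ge0 ?exprn_ge0 ?mulr_ge0 ?ler0n.
rewrite -!powR_mulrn ?(ltW n0) // => main.
have := @ge0_ler_powR R (93^-1) _ _ _ _ _ main.
rewrite -!powRrM divff // powRr1 //.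
by apply; rewrite ?nnegrE ?powR_ge0.
Qed.

End LogBounds.

(** * Reduction to positive elements *)

Section PositivePart.
Variable R : realFieldType.

(** Two elements guarantee a y with y + a nonzero, and x(y + a) is then injective in x. This lets
    the logarithm of |A(A + a)| replace that of |A|. *)
Lemma card_le_shifted_products (A : {fset R}) (a : R) :
  (1 < #|` A|%fset)%N -> (#|` A|%fset <= #|` shifted_products A a|%fset)%N.
Proof.
move=> A2.
have [y yA ya] : exists2 y, y \in A & y + a != 0.
  have Am : (0 < #|` (A `\ (- a))|%fset)%N.
    by move: A2; rewrite (cardfsD1 (- a) A); case: (_ \in _) => //=; case: #|` _|%fset.
  move: Am; rewrite cardfs_gt0 => /fset0Pn[y]; rewrite !inE => /andP[yna yA].
  by exists y => //; rewrite addr_eq0.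
have <- : #|` [fset x * (y + a) | x in A]|%fset = #|` A|%fset.
  by rewrite card_imfset //; apply: mulIf.
apply: fsubset_leq_card; apply/fsubsetP => _ /imfsetP[x xA ->].
by apply/imfset2P; exists x => //; exists y.
Qed.

(** The larger of the positive part and the reflected negative part is taken; reflection is harmless
    since (-x)(-y - a) = x(y + a). As 0 costs one element, |A| <= 2|P| + 1 <= 3|P|. *)
Lemma exists_positive_part (A : {fset R}) : (1 < #|` A|%fset)%N ->
  exists P : {fset R},
   [/\ forall x, x \in P -> 0 < x, (0 < #|` P|%fset)%N,
       (#|` A|%fset <= 3 * #|` P|%fset)%N, (#|` P|%fset <= #|` A|%fset)%N
     & forall a, a \in P -> exists2 a', a' \in A
        & (shifted_products P a `<=` shifted_products A a')%fset].
Proof.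
move=> A2.
pose P := [fset x in A | 0 < x]%fset; pose N := [fset x in A | x < 0]%fset.
pose N' := [fset - x | x in N]%fset.
have PA x : x \in P -> x \in A /\ 0 < x by rewrite !inE => /andP[].
have NA x : x \in N' -> - x \in A /\ 0 < x.
  by move=> /imfsetP[y + ->]; rewrite /= !inE opprK oppr_gt0 => /andP[].
have cN' : #|` N'|%fset = #|` N|%fset by rewrite card_imfset //; apply: oppr_inj.
have cP : (#|` P|%fset <= #|` A|%fset)%N by apply: fsubset_leq_card; apply: fset_sub.
have cN : (#|` N|%fset <= #|` A|%fset)%N by apply: fsubset_leq_card; apply: fset_sub.
have cA : (#|` A|%fset <= (#|` P|%fset + #|` N|%fset).+1)%N.
  have sub : (A `<=` 0 |` (P `|` N))%fset.
    by apply/fsubsetP => x xA; rewrite !inE xA /=; case: ltgtP; rewrite ?orbT.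
  apply: leq_trans (fsubset_leq_card sub) _; rewrite cardfsU1.
  apply: (@leq_trans (1 + #|` (P `|` N)|%fset)%N); first by rewrite leq_add2r leq_b1.
  by rewrite add1n ltnS cardfsU leq_subr.

have [NP|PN] := leqP #|` N|%fset #|` P|%fset.
  exists P; split=> //; try by [lia|move=> x /PA[]].
  move=> a /PA[aA _]; exists a => //.
  apply/fsubsetP => _ /imfset2P[x /PA[xA _] [y /PA[yA _] ->]].
  by apply/imfset2P; exists x => //; exists y.
exists N'; rewrite cN'; split=> //; try by [lia|move=> x /NA[]].
move=> a /NA[aA _]; exists (- a) => //.
apply/fsubsetP => _ /imfset2P[x /NA[xA _] [y /NA[yA _] ->]].
apply/imfset2P; exists (- x) => //; exists (- y) => //.
by rewrite -opprD mulrNN.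
Qed.

End PositivePart.

Section GrowthExponent.
Variable R : realType.

(** The square of the logarithm is the [h ^+ 2] of [growth_bound], and 36 = 6^2 comes from h = 6L.
    The factor 9 = 3^2 bounds 3^(140/93), the loss in the positive part. *)
Lemma shifted_products_growth (A : {fset R}) : (1 < #|` A|%fset)%N ->
  exists2 a, a \in A &
    (9 * (2 ^+ 13 * 36))^-1 * (#|` A|%fset%:R : R) `^ (3 / 2 + 1 / 186) <=
    #|` shifted_products A a|%fset%:R
     * (ln (#|` shifted_products A a|%fset%:R) / ln 2 : R) `^ 2.
Proof.
have -> : 3 / 2 + 1 / 186 = 140 / 93 :> R by lra.
move=> A2; have [P [P0 P1 AP PA shiftP]] := exists_positive_part A2.
have /andP[l20 l21] := ln2_bounds R.
set n := #|` A|%fset in A2 AP PA *.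
have n0 : 0 < n%:R :> R by rewrite ltr0n (leq_trans _ A2).
pose L : R := ln n%:R / ln 2.
have L1 : 1 <= L by rewrite ler_pdivlMr // mul1r ler_ln ?posrE // ler_nat.
have lnP : ln (#|` P|%fset%:R : R) <= L * ln 2.
  by rewrite divfK ?gt_eqF // ler_ln ?posrE // ?ltr0n // ler_nat.
have [b bP growth] := positive_growth P0 P1 L1 lnP.
have [a aA sub] := shiftP b bP; exists a => //.
have cS := card_le_shifted_products a A2; rewrite -/n in cS.
set s := #|` shifted_products A a|%fset in cS *.
have s0 : 0 < s%:R :> R by rewrite ltr0n (leq_trans _ cS) // (leq_trans _ A2).
have Ls : L <= ln s%:R / ln 2.
  by rewrite ler_pM2r ?invr_gt0 // ler_ln ?posrE // ler_nat.
set l := ln s%:R / ln 2 in Ls *; clearbody L l.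
have L0 : 0 <= L by apply: le_trans L1.
have l0 : 0 <= l by apply: le_trans Ls.
have cPs : (#|` shifted_products P b|%fset)%:R <= s%:R :> R.
  by rewrite ler_nat fsubset_leq_card.
have nP : n%:R `^ (140 / 93) <= 9 * #|` P|%fset%:R `^ (140 / 93) :> R.
  apply: (@le_trans _ _ ((3 * #|` P|%fset%:R) `^ (140 / 93))).
    by apply: ge0_ler_powR; rewrite ?nnegrE ?divr_ge0 ?ler0n // -natrM ler_nat.
  rewrite powRM ?ler0n // ler_wpM2r ?powR_ge0 //.
  apply: (@le_trans _ _ (3 `^ 2%:R)); last by rewrite powR_mulrn // expr2; lra.
  by apply: ler_powR; lra.
rewrite (powR_mulrn 2) // ler_pdivrMl ?mulr_gt0 ?exprn_gt0 ?ltr0n //.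
apply: le_trans nP _; rewrite -[leRHS]mulrA ler_wpM2l ?ler0n //.
apply: le_trans growth _.
have -> : 2 ^+ 13 * 36 * (s%:R * l ^+ 2) =
   2 ^+ 13 * (6 * l) ^+ 2 * s%:R :> R by ring.
apply: ler_pM; rewrite ?mulr_ge0 ?exprn_ge0 ?mulr_ge0 ?ler0n //.
rewrite ler_wpM2l ?exprn_ge0 ?ler0n // lerXn2r ?nnegrE ?mulr_ge0 ?ler0n //.
by rewrite ler_wpM2l ?ler0n.
Qed.

End GrowthExponent.

From Stdlib Require Import Rdefinitions.
Local Open Scope ring_scope.
Local Open Scope fset_scope.

(** Two elements are required because for a singleton the product set has one element, its logarithm
    is 0 and the right side vanishes. *)
Theorem theorem1p1 :
  exists (c C : Rdefinitions.R), 0 < c /\ 0 < C /\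
    forall A : {fset Rdefinitions.R}, leq 2 #|` A| ->
      exists2 a, a \in A &
        c * ((#|` A|%:R : Rdefinitions.R) `^ (3 / 2 + 1 / 186))
          <= (#|` prodShift A a|%:R : Rdefinitions.R)
             * (log2 (#|` prodShift A a|%:R)) `^ C.
Proof.
have c0 : 0 < (9 * (2 ^+ 13 * 36))^-1 :> Rdefinitions.R.
  by rewrite invr_gt0 !mulr_gt0 ?exprn_gt0 ?ltr0n.
exists (9 * (2 ^+ 13 * 36))^-1, 2; split=> //; split=> // A A2.
exact: shifted_products_growth A2.
Qed.
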